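(* There exist universal constants $C, C_1, C_2, D_1, D_2, \gamma > 0$ such that the following holds. Let $N, m, s \in \mathbb{N}$ satisfy $$m \geq C s \log^3(s) \log(N).$$ Let $x_1, \dots, x_m$ be drawn independently at random from the Chebyshev probability measure $d\nu(x) = \pi^{-1}(1-x^2)^{-1/2}\,dx$ on $[-1,1]$. Let $\Phi \in \mathbb{R}^{m \times N}$ be the Legendre matrix with entries $\Phi_{j,k} = L_{k-1}(x_j)$, $j \in [m]$, $k \in [N]$, and let $\mathcal{A}$ be the $m \times m$ diagonal matrix with diagonal entries $a_{j,j} = (\pi/2)^{1/2}(1-x_j^2)^{1/4}$. Then with probability exceeding $1 - N^{-\gamma \log^3(s)}$ the following holds simultaneously for all polynomials $g(x) = \sum_{k=0}^{N-1} c_k L_k(x)$ with $c = (c_0, \dots, c_{N-1}) \in \mathbb{R}^N$: whenever $y = (g(x_1)+\eta_1, \dots, g(x_m)+\eta_m) = \Phi c + \eta$ with $\eta \in \mathbb{R}^m$ satisfying $\|\mathcal{A}\eta\|_\infty \leq \varepsilon$, any minimizer $$c^{\#} \in \arg\min_{z \in \mathbb{R}^N} \|z\|_1 \quad \text{subject to} \quad \|\mathcal{A}\Phi z - \mathcal{A}y\|_2 \leq \sqrt{m}\,\varepsilon$$ satisfies $$\|c - c^{\#}\|_2 \leq \frac{C_1 \sigma_s(c)_1}{\sqrt{s}} + C_2 \varepsilon \quad\text{and}\quad \|c - c^{\#}\|_1 \leq D_1 \sigma_s(c)_1 + D_2\sqrt{s}\,\varepsilon.$$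
   Context: $L_n$ ($n \ge 0$) denotes the Legendre polynomial of degree $n$, normalized so that $\frac{1}{2}\int_{-1}^1 L_n(x)L_\ell(x)\,dx = \delta_{n,\ell}$. For $N\in\mathbb{N}$, $[N]=\{1,\dots,N\}$. For $z \in \mathbb{R}^N$, $\|z\|_p$ is the usual $\ell_p$-norm, $\|z\|_0$ the number of nonzero entries, and $\sigma_s(z)_1 = \inf\{\|y - z\|_1 : y\in\mathbb{R}^N,\ \|y\|_0 \leq s\}$ is the error of best $s$-term approximation in $\ell_1$. $\varepsilon \ge 0$ is arbitrary.
   Formalization: ''Probability exceeding'' is read as ''at least'': the strict claim fails at s=1 (e.g. m=1, N=2, ε=0, where the bound is 0 and recovery of both unit vectors fails surely); for s,N≥2 strictness follows by halving γ. *)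

(* Defs.v *)
From HB Require Import structures.
From mathcomp Require Import all_boot all_order all_algebra.
From mathcomp Require Import all_classical all_reals all_analysis.
From mathcomp Require Import Rstruct Rstruct_topology.
Set Implicit Arguments. Unset Strict Implicit. Unset Printing Implicit Defensive.
Import Order.TTheory GRing.Theory Num.Theory.
Local Open Scope classical_set_scope.
Local Open Scope ring_scope.

Notation R := Rdefinitions.R.
Notation Rm := (measurableTypeR Rdefinitions.R).

(* Classical Legendre polynomial P_n (P_n(1) = 1), Rodrigues' formula:
   P_n = 1/(2^n n!) d^n/dx^n (x^2 - 1)^n. *)
Definition legendreP (n : nat) : {poly R} :=
  ((2 ^+ n * (n`!)%:R)^-1) *: derivn n (('X ^+ 2 - 1) ^+ n).

(* Normalized Legendre polynomial: (1/2) \int_{-1}^1 L_n L_l = delta_{n,l},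
   i.e. L_n = sqrt(2n+1) P_n. *)
Definition legendreL (n : nat) (x : R) : R :=
  Num.sqrt (2 * n%:R + 1) * (legendreP n).[x].

Definition norm1 {n : nat} (z : 'I_n -> R) : R := \sum_(k < n) `|z k|.
Definition norm2 {n : nat} (z : 'I_n -> R) : R := Num.sqrt (\sum_(k < n) z k ^+ 2).
Definition norminf {n : nat} (z : 'I_n -> R) : R := \big[Num.max/0]_(k < n) `|z k|.
Definition norm0 {n : nat} (z : 'I_n -> R) : nat := #|[set k : 'I_n | z k != 0]|.

Definition sigma_s1 {n : nat} (s : nat) (z : 'I_n -> R) : R :=
  inf [set r : R | exists y : 'I_n -> R,
         (norm0 y <= s)%N /\ r = norm1 (fun k => y k - z k)].

Definition cheb_density (x : R) : R := (pi * Num.sqrt (1 - x ^+ 2))^-1.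

Definition chebyshev_measure (A : set R) : \bar R :=
  (\int[@lebesgue_measure R]_(x in A `&` `](-1)%R, 1%R[) (cheb_density x)%:E)%E.

Definition mutually_independent {d : measure_display} {T : measurableType d}
    (P : probability T R) (m : nat) (X : 'I_m -> T -> Rm) : Prop :=
  forall A : 'I_m -> set Rm, (forall j, measurable (A j)) ->
    P [set t | forall j, A j (X j t)] =
      (\big[*%E/1%E]_(j < m) P (X j @^-1` A j))%E.

Definition legendre_mat {m N : nat} (x : 'I_m -> R) (z : 'I_N -> R) : 'I_m -> R :=
  fun j => \sum_(k < N) legendreL k (x j) * z k.

Definition precond (t : R) : R :=
  Num.sqrt (pi / 2) * Num.sqrt (Num.sqrt (1 - t ^+ 2)).

Definition is_l1_minimizer {m N : nat} (x : 'I_m -> R) (y : 'I_m -> R)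
    (eps : R) (cs : 'I_N -> R) : Prop :=
  let feasible (z : 'I_N -> R) :=
    norm2 (fun j => precond (x j) * legendre_mat x z j - precond (x j) * y j)
      <= Num.sqrt m%:R * eps in
  feasible cs /\ forall z, feasible z -> norm1 cs <= norm1 z.

Definition recovery_property {m N : nat} (s : nat) (C1 C2 D1 D2 eps : R)
    (x : 'I_m -> R) : Prop :=
  forall (c : 'I_N -> R) (eta : 'I_m -> R),
    norminf (fun j => precond (x j) * eta j) <= eps ->
    let y := fun j => legendre_mat x c j + eta j in
    forall cs : 'I_N -> R, is_l1_minimizer x y eps cs ->
      norm2 (fun k => c k - cs k) <= C1 * sigma_s1 s c / Num.sqrt s%:R + C2 * eps /\
      norm1 (fun k => c k - cs k) <= D1 * sigma_s1 s c + D2 * Num.sqrt s%:R * eps.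

(* Main.v *)
Require Import Defs.
From HB Require Import structures.
From mathcomp Require Import all_boot all_order all_algebra.
From mathcomp Require Import all_classical all_reals all_analysis.
From mathcomp Require Import Rstruct Rstruct_topology.
From mathcomp Require Import measurable_realfun.
From mathcomp Require Import ring lra.
Set Implicit Arguments. Unset Strict Implicit. Unset Printing Implicit Defensive.
Import Order.TTheory GRing.Theory Num.Theory.
Import numFieldNormedType.Exports.
Local Open Scope classical_set_scope.
Local Open Scope ring_scope.

(* Proof idea (a one-sided variant of the Haviv-Regev argument).  The preconditioned
   functions a_k x = precond x * L_k x are orthonormal for the Chebyshev measure and, by
   Sonin's monotonicity argument for the Legendre equation, bounded by 2.  Recovery only
   needs the lower bound  m / 400 * |v|_2 ^ 2 <= sum_j f_v (x_j) ^ 2,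
   f_v = sum_k v_k a_k,  for v in the cone |v|_1 <= 4 sqrt s |v|_2.  When |v|_2 = 1,
   |f_v| <= B = 8 sqrt s.  By a dyadic layer cake decomposition the energies of f_v for
   the true and for the empirical measure are comparable to
   sum_i (B / 2 ^ i) ^ 2 * measure {|f_v| >= B / 2 ^ i}.  At level i, f_v is replaced by
   the average of O (4 ^ i log s) random signed atoms (Maurey), which is within
   B / 2 ^ (i + 1) of f_v off a set that is small for both measures.  These averages range
   over a finite family, so the union bound and a Chernoff lower tail apply.  Giving level
   i the additive deviation (1 + 4 ^ i / t) / (1600 B ^ 2), for t = O (log s) levels, makes
   the total failure probability exp (- c m / s). *)

(** * Deterministic recovery *)

Lemma norm2_ge0 (n : nat) (z : 'I_n -> R) : 0 <= norm2 z.
Proof. exact: sqrtr_ge0. Qed.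

Lemma norm1_ge0 (n : nat) (z : 'I_n -> R) : 0 <= norm1 z.
Proof. by apply: sumr_ge0 => k _; apply: normr_ge0. Qed.

Lemma norm2_sq (n : nat) (z : 'I_n -> R) : norm2 z ^+ 2 = \sum_(k < n) z k ^+ 2.
Proof. by rewrite sqr_sqrtr //; apply: sumr_ge0 => k _; apply: sqr_ge0. Qed.

(** Cauchy-Schwarz against the constant 1: the squares of [#|A| * |z k| - S] add up to
    [#|A| * (#|A| * Q - S ^ 2)], which is therefore nonnegative. *)
Lemma sum_sqr_le_card (I : finType) (A : {set I}) (z : I -> R) :
  (\sum_(k in A) `|z k|) ^+ 2 <= #|A|%:R * \sum_(k in A) z k ^+ 2.
Proof.
set S := \sum_(k in A) `|z k|; set Q := \sum_(k in A) z k ^+ 2.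
have [A0|A0] := posnP #|A|.
  by rewrite /S /Q A0 mul0r !big1 ?expr0n // => k; rewrite (cards0_eq A0) inE.
have c0 : 0 < #|A|%:R :> R by rewrite ltr0n.
have : 0 <= \sum_(k in A) (#|A|%:R * `|z k| - S) ^+ 2.
  by apply: sumr_ge0 => k _; apply: sqr_ge0.
have -> : \sum_(k in A) (#|A|%:R * `|z k| - S) ^+ 2 =
    \sum_(k in A) (#|A|%:R ^+ 2 * z k ^+ 2 - (2 * #|A|%:R * S) * `|z k| + S ^+ 2).
  by apply: eq_bigr => k _; rewrite -[z k ^+ 2]real_normK ?num_real //; ring.
rewrite big_split sumrB /= sumr_const -!mulr_sumr -/Q -/S -[S ^+ 2 *+ _]mulr_natl => h.
by rewrite -(ler_pM2l c0); nra.
Qed.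

Lemma norm1_supp (n s : nat) (A : {set 'I_n}) (z : 'I_n -> R) :
  (#|A| <= s)%N -> \sum_(k in A) `|z k| <= Num.sqrt s%:R * norm2 z.
Proof.
move=> As; rewrite -(@ler_pXn2r _ 2) ?nnegrE //; last 2 first.
- by apply: sumr_ge0.
- by rewrite mulr_ge0 ?sqrtr_ge0.
rewrite exprMn sqr_sqrtr ?ler0n // norm2_sq.
apply: (le_trans (sum_sqr_le_card A z)).
apply: ler_pM; rewrite ?ler0n ?ler_nat //.
  by apply: sumr_ge0 => k _; apply: sqr_ge0.
rewrite [leRHS](bigID (mem A)) /= lerDl.
by apply: sumr_ge0 => k _; apply: sqr_ge0.
Qed.


(** [norm0] counts a classical set; the finite set on the right can serve as a support in sums. *)
Lemma norm0E (n : nat) (z : 'I_n -> R) : norm0 z = #|[set k : 'I_n | z k != 0]%SET|.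
Proof. by apply: eq_card => k; rewrite !inE; apply/asboolP/idP. Qed.

(** Bounds are proved for each [s]-sparse competitor and then passed to the infimum, so no best
    approximation has to be exhibited. The zero vector makes the set nonempty, as a lower bound on
    [inf] requires. *)
Lemma sigma_s1_ub (n s : nat) (c : 'I_n -> R) (a k e : R) : 0 < k ->
  (forall y : 'I_n -> R, (norm0 y <= s)%N -> a <= k * norm1 (fun i => y i - c i) + e) ->
  a <= k * sigma_s1 s c + e.
Proof.
move=> k0 H; rewrite -lerBlDr -ler_pdivrMl //.
apply: lb_le_inf.
  exists (norm1 (fun i : 'I_n => 0 - c i)), (fun=> 0); split=> //.
  by rewrite norm0E eq_card0 // => i; rewrite inE eqxx.
move=> _ [y [ys ->]]; rewrite ler_pdivrMl // lerBlDr; exact: H.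
Qed.

(** Let [A] be the support of [y] and [v = c - cs]. Splitting [norm1 cs <= norm1 c] along [A] bounds
    the l1 mass of [v] off [A] by its mass on [A] plus twice the mass of [c] off [A]. The mass on
    [A] is at most [sqrt s * norm2 v], and off [A] the vector [y] vanishes, so [c] coincides there
    with [c - y]. *)
Lemma l1_cone (n s : nat) (c cs y : 'I_n -> R) :
  (norm0 y <= s)%N -> norm1 cs <= norm1 c ->
  norm1 (fun k => c k - cs k) <=
    2 * Num.sqrt s%:R * norm2 (fun k => c k - cs k) + 2 * norm1 (fun k => y k - c k).
Proof.
rewrite norm0E => ys cscle; pose A := [set k : 'I_n | y k != 0]%SET.
have := norm1_supp (fun k => c k - cs k) ys; rewrite -/A.
set w := _ * norm2 _ => hw.
have split1 (z : 'I_n -> R) : norm1 z = \sum_(k in A) `|z k| + \sum_(k in ~: A) `|z k|.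
  by rewrite /norm1 (bigID (mem A)) /=; congr (_ + _); apply: eq_bigl => k; rewrite !inE.
have h1 : \sum_(k in A) `|c k| <= \sum_(k in A) `|cs k| + \sum_(k in A) `|c k - cs k|.
  rewrite -big_split; apply: ler_sum => k _ /=.
  by rewrite addrC -lerBlDr lerB_dist.
have h2 : \sum_(k in ~: A) `|c k - cs k| <=
    \sum_(k in ~: A) `|cs k| + \sum_(k in ~: A) `|c k|.
  by rewrite -big_split; apply: ler_sum => k _ /=; rewrite addrC ler_normB.
have h3 : \sum_(k in ~: A) `|c k| <= norm1 (fun k => y k - c k).
  rewrite split1 -[leLHS]add0r; apply: lerD; first exact: sumr_ge0.
  by apply: ler_sum => k; rewrite !inE negbK => /eqP ->; rewrite sub0r normrN.
move: cscle; rewrite !split1.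
rewrite -mulrA -/w.
move: h1 h2 h3 hw; rewrite !split1.
lra.
Qed.

Lemma norm_le_norminf (n : nat) (z : 'I_n -> R) (k : 'I_n) : `|z k| <= norminf z.
Proof. by rewrite /norminf; exact: (le_bigmax (0 : R) (fun k => `|z k|) k). Qed.

Lemma norm2_le_norminf (n : nat) (z : 'I_n -> R) (e : R) :
  norminf z <= e -> norm2 z <= Num.sqrt n%:R * e.
Proof.
move=> ze; have e0 : 0 <= e by apply: le_trans ze; exact: bigmax_ge_id.
rewrite -(@ler_pXn2r _ 2) ?nnegrE ?norm2_ge0 ?mulr_ge0 ?sqrtr_ge0 //.
rewrite norm2_sq exprMn sqr_sqrtr ?ler0n //.
rewrite mulr_natl -[X in _ *+ X]card_ord -sumr_const; apply: ler_sum => k _.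
rewrite -[leLHS]real_normK ?num_real // ler_pXn2r ?nnegrE //.
exact: le_trans (norm_le_norminf z k) ze.
Qed.

(* Only the case where the error vector lies in the cone
   [norm1 v <= 4 * sqrt s * norm2 v] needs the measurements: outside of it the l1
   cone inequality already bounds [norm2 v] by [sigma_s1 / sqrt s]. *)
Lemma recovery_of_restricted_lower_bound (m N s : nat) (k eps : R) (x : 'I_m -> R) :
  (0 < m)%N -> (0 < s)%N -> 0 < k -> 0 <= eps ->
  (forall v : 'I_N -> R, norm1 v <= 4 * Num.sqrt s%:R * norm2 v ->
     k ^+ 2 * m%:R * norm2 v ^+ 2 <=
       \sum_(j < m) (precond (x j) * legendre_mat x v j) ^+ 2) ->
  @recovery_property m N s 1 (2 / k) 4 (4 / k) eps x.
Proof.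
move=> m0 s0 k0 eps0 Hk c eta etale y cs [feas cmin].
have m0' : 0 < m%:R :> R by rewrite ltr0n.
set v := fun k => c k - cs k.
set q := Num.sqrt s%:R.
have q0 : 0 < q by rewrite sqrtr_gt0 ltr0n.
have lin (j : 'I_m) : legendre_mat x v j = legendre_mat x c j - legendre_mat x cs j.
  by rewrite /legendre_mat -sumrB; apply: eq_bigr => i _; rewrite mulrBr.
(* The vector [c] is itself feasible: its residual is the preconditioned noise. *)
have cscle : norm1 cs <= norm1 c.
  apply: cmin; apply: (@le_trans _ _ (norm2 (fun j => - (precond (x j) * eta j)))).
    rewrite le_eqVlt; apply/orP; left; apply/eqP; congr norm2.
    by apply/funext => j; rewrite /y; ring.
  apply: norm2_le_norminf; rewrite (_ : norminf _ = norminf (fun j => precond (x j) * eta j)) //.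
  by rewrite /norminf; apply: eq_bigr => j _; rewrite normrN.
(* The residuals of [c] and of [cs] both have squared norm at most [m * eps ^ 2]; their difference
   is the measurement of [v], whence the factor 4. *)
have fit : \sum_(j < m) (precond (x j) * legendre_mat x v j) ^+ 2 <= 4 * m%:R * eps ^+ 2.
  have sq (z : 'I_m -> R) : norm2 z <= Num.sqrt m%:R * eps ->
      \sum_(j < m) z j ^+ 2 <= m%:R * eps ^+ 2.
    move=> hz; rewrite -norm2_sq -(@sqr_sqrtr _ m%:R) ?ler0n // -exprMn.
    by rewrite ler_pXn2r ?nnegrE ?norm2_ge0 // mulr_ge0 ?sqrtr_ge0.
  have {}feas := sq _ feas; have etale2 := sq _ (norm2_le_norminf etale).
  apply: (@le_trans _ _ (\sum_(j < m) (2 * (precond (x j) * legendre_mat x cs j -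
      precond (x j) * y j) ^+ 2 + 2 * (precond (x j) * eta j) ^+ 2))); last first.
    by rewrite big_split /= -!mulr_sumr; lra.
  apply: ler_sum => j _; rewrite lin /y.
  set a := precond _; set b := legendre_mat _ _ _; set d := legendre_mat _ _ _.
  rewrite -subr_ge0 (_ : _ - _ = (a * (d - b) - 2 * (a * eta j)) ^+ 2); last by ring.
  exact: sqr_ge0.
have v0 := norm2_ge0 v.
have incone : norm1 v <= 4 * q * norm2 v -> norm2 v <= 2 / k * eps.
  move=> /Hk/le_trans/(_ fit) h.
  rewrite -(@ler_pXn2r _ 2) ?nnegrE ?mulr_ge0 ?invr_ge0 ?(ltW k0) //.
  rewrite exprMn expr_div_n mulrAC ler_pdivlMr ?exprn_gt0 //.
  by rewrite -(ler_pM2l m0'); move: h; lra.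
have key (z : 'I_N -> R) : (norm0 z <= s)%N ->
    norm2 v <= q^-1 * norm1 (fun i => z i - c i) + 2 / k * eps /\
    norm1 v <= 4 * norm1 (fun i => z i - c i) + 4 / k * q * eps.
  move=> zs; have := l1_cone zs cscle; rewrite -/q -/v.
  set w := norm1 (fun i => z i - c i) => cone.
  have w0 : 0 <= w by exact: norm1_ge0.
  have e0 : 0 <= 2 / k * eps by rewrite !mulr_ge0 ?invr_ge0 ?(ltW k0).
  rewrite (_ : 4 / k * q * eps = 2 * q * (2 / k * eps)); last by ring.
  (* Inside the cone the measurements bound [norm2 v]. Outside, [4 * q * norm2 v < norm1 v <= 2 * q
     * norm2 v + 2 * w] forces [q * norm2 v <= w], hence [norm1 v <= 4 * w]. *)
  have [/incone h|h] := leP (norm1 v) (4 * q * norm2 v).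
    have wq : 0 <= q^-1 * w by rewrite mulr_ge0 // invr_ge0 ltW.
    by split; [lra | nra].
  have h' : q * norm2 v <= w by lra.
  split; last by nra.
  by rewrite -[leLHS]addr0 lerD // ler_pdivlMl.
split.
  rewrite mul1r [sigma_s1 s c / _]mulrC; apply: sigma_s1_ub; first by rewrite invr_gt0.
  by move=> z /key[].
by apply: sigma_s1_ub => // z /key[].
Qed.

(** * Maurey approximation and the Chernoff bound *)

Lemma measure_finite_union_le (d : measure_display) (T : measurableType d)
    (mu : {measure set T -> \bar R}) (I : finType) (A : I -> set T) (c : I -> R) :
  (forall i, measurable (A i)) -> (forall i, (mu (A i) <= (c i)%:E)%E) ->
  measurable [set t | exists i, A i t] /\
  (mu [set t | exists i, A i t] <= (\sum_i c i)%:E)%E.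
Proof.
move=> mA Ac.
have -> : [set t | exists i, A i t] = \big[setU/set0]_(i <- index_enum I) A i.
  apply/seteqP; split=> [t [i Ait]|t]; rewrite -bigcup_seq; last by case=> i _; exists i.
  by exists i => //=; rewrite mem_index_enum.
elim: (index_enum I) => [|i r [mr IH]]; first by rewrite !big_nil measure0.
rewrite !big_cons; split; first exact: measurableU.
apply: le_trans; first (apply: measureU2; [exact: mA|exact: mr]).
rewrite EFinD; apply: leeD; [exact: Ac | exact: IH].
Qed.

Lemma mutually_independent_pattern (d : measure_display) (T : measurableType d)
    (P : probability T R) (m : nat) (X : 'I_m -> T -> Rm) (A : 'I_m -> set Rm) (q : 'I_m -> R) :
  (forall j, measurable_fun setT (X j)) -> mutually_independent P X ->
  (forall j, measurable (A j)) -> (forall j, P (X j @^-1` A j) = (q j)%:E) ->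
  measurable [set t | forall j, A j (X j t)] /\
  P [set t | forall j, A j (X j t)] = (\prod_j q j)%:E.
Proof.
move=> mX iX mA PA; split.
  rewrite (_ : [set _ | _] = \bigcap_(j in setT) (X j @^-1` A j)).
    apply: fin_bigcap_measurable => // j _.
    by rewrite -[_ @^-1` _]setTI; apply: mX.
  by apply/seteqP; split=> t /= H j; [move=> _|]; exact: H.
rewrite iX // -prodEFin.
by apply: eq_bigr => j _.
Qed.

(** The exponential moment is computed as a finite sum over the hit patterns [f] of the sample,
    whose probabilities are products by independence. On a low pattern [M * expR (- count)] is at
    least 1, and summing over all patterns gives [M * (q / e + 1 - q) ^ m <= M * expR (- q * m /
    2)]. The loss from [q] to [q / 4] in the threshold more than absorbs the remaining terms in
    [q]. *)
Lemma chernoff_lower_tail (d : measure_display) (T : measurableType d)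
    (P : probability T R) (m : nat) (X : 'I_m -> T -> Rm) (A : set Rm) (q eta : R) :
  (forall j, measurable_fun setT (X j)) -> mutually_independent P X ->
  measurable A -> (forall j, P (X j @^-1` A) = q%:E) -> 0 <= q <= 1 ->
  let S := [set t | \sum_(j < m) \1_A (X j t) < m%:R * (q / 4 - eta)] in
  measurable S /\ (P S <= (expR (- (m%:R * eta)))%:E)%E.
Proof.
move=> mX iX mA PA /andP[q0 q1] S.
pose sel (b : bool) := if b then A else ~` A.
pose w (b : bool) := if b then q else 1 - q.
pose low (f : {ffun 'I_m -> bool}) := (\sum_(j < m) (f j)%:R < m%:R * (q / 4 - eta)).
(* Patterns that are not low get the empty event, so that the union over all patterns is exactly
   [S]. *)
pose E f := if low f then [set t | forall j, sel (f j) (X j t)] else set0.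
have w0 b : 0 <= w b by case: b => //=; rewrite subr_ge0.
have hE f := mutually_independent_pattern mX iX
   (A := fun j => sel (f j)) (q := fun j => w (f j)).
have mE f : measurable (E f) /\ (P (E f) <= (if low f then \prod_j w (f j) else 0)%:E)%E.
  rewrite /E; case: ifP => _; last by rewrite measure0.
  have mA' j : measurable (sel (f j)).
    by rewrite /sel; case: (f j) => //; exact: measurableC.
  have PA' j : P (X j @^-1` sel (f j)) = (w (f j))%:E.
    rewrite /sel /w; case: (f j) => //.
    have mXA : measurable (X j @^-1` A) by rewrite -[_ @^-1` _]setTI; apply: mX.
    by rewrite preimage_setC probability_setC // PA.
  by have [m1 ->] := hE f mA' PA'.
have -> : S = [set t | exists f, E f t].
  apply/seteqP; split=> [t /= St|t [f]].
    exists [ffun j => `[< A (X j t) >]]; rewrite /E (_ : low _) => [j|].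
      by rewrite ffunE /sel; case: asboolP.
    rewrite /low; apply: le_lt_trans St; apply: ler_sum => j _.
    by rewrite ffunE indicE.
  rewrite /E; case: ifP => // lf fX; rewrite /S /=.
  apply: le_lt_trans lf; apply: ler_sum => j _; have := fX j.
  by rewrite indicE /sel; case: (f j) => h; [rewrite mem_set | rewrite memNset].
have [mS leS] := measure_finite_union_le (fun f => (mE f).1) (fun f => (mE f).2).
split=> //; apply: (le_trans leS); rewrite lee_fin.
pose z := expR (-1 : R).
have z_half : z <= 1 / 2.
  rewrite /z expRN div1r lef_pV2 ?posrE ?expR_gt0 //.
  by apply: le_trans (expR_ge1Dx 1); lra.
pose M := expR (m%:R * (q / 4 - eta)).
apply: (@le_trans _ _ (\sum_(f : {ffun 'I_m -> bool})
    M * \prod_j (w (f j) * (if f j then z else 1)))).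
  apply: ler_sum => f _; have [lf|_] := ifP; last first.
    rewrite mulr_ge0 ?expR_ge0 // prodr_ge0 // => j _; rewrite mulr_ge0 //.
    by case: (f j) => //; exact: expR_ge0.
  rewrite big_split /= mulrCA ler_peMr ?prodr_ge0 //.
  have -> : \prod_(j < m) (if f j then z else 1) = expR (- \sum_(j < m) (f j)%:R).
    rewrite -sumrN expR_sum; apply: eq_bigr => j _; rewrite /z.
    by case: (f j); rewrite ?mulr1n ?mulr0n ?oppr0 ?exp.expR0.
  by rewrite -exp.expRD -[leLHS]exp.expR0 ler_expR subr_ge0 ltW.
rewrite -mulr_sumr -(bigA_distr_bigA (fun j b => w b * (if b then z else 1))).
rewrite big_const_ord iter_mulr_1 big_bool /= mulr1.
apply: (@le_trans _ _ (M * expR (- (q / 2)) ^+ m)).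
  rewrite ler_wpM2l ?expR_ge0 // lerXn2r ?nnegrE ?expR_ge0 //.
    by rewrite addr_ge0 ?mulr_ge0 ?expR_ge0 // subr_ge0.
  by apply: le_trans (expR_ge1Dx _); nra.
rewrite -expRM_natl -exp.expRD ler_expR.
have : 0 <= m%:R :> R by exact: ler0n.
by nra.
Qed.

(** From [1 - y <= expR (- y)] one gets [expR y <= 1 / (1 - y)], and [(1 + y + 2 y ^ 2) (1 - y) = 1
    + y ^ 2 (1 - 2 y)] is at least 1. *)
Lemma expR_le_quadratic (K : realType) (y : K) : y <= 1 / 2 -> expR y <= 1 + y + 2 * y ^+ 2.
Proof.
move=> y12; have y1 : 0 < 1 - y by lra.
rewrite -[y]opprK expRN opprK.
apply: (@le_trans _ _ (1 - y)^-1).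
  by rewrite lef_pV2 ?posrE ?expR_gt0 // expR_ge1Dx.
rewrite -div1r ler_pdivrMr //.
have -> : (1 + y + 2 * y ^+ 2) * (1 - y) = 1 + y ^+ 2 * (1 - 2 * y) by ring.
by rewrite lerDl mulr_ge0 ?sqr_ge0 //; lra.
Qed.

Lemma le_convex_comb (K : realType) (I : finType) (p c : I -> K) (B : K) :
  (forall i, 0 <= p i) -> \sum_i p i = 1 -> (forall i, `|c i| <= B) ->
  `|\sum_i p i * c i| <= B.
Proof.
move=> p0 p1 cB; apply: (le_trans (ler_norm_sum _ _ _)).
rewrite -[leRHS]mul1r -p1 mulr_suml; apply: ler_sum => i _.
by rewrite normrM ger0_norm // ler_wpM2l.
Qed.

(** In the quadratic bound for the exponential the linear term averages to zero, and the deviations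
    from the mean are at most [2 * B]. *)
Lemma mgf_convex_comb (K : realType) (I : finType) (p c : I -> K) (B l : K) :
  (forall i, 0 <= p i) -> \sum_i p i = 1 -> (forall i, `|c i| <= B) ->
  `|l| * (2 * B) <= 1 / 2 ->
  \sum_i p i * expR (l * (c i - \sum_i p i * c i)) <= expR (8 * l ^+ 2 * B ^+ 2).
Proof.
move=> p0 p1 cB lB; set f := \sum_i p i * c i.
have fB : `|f| <= B by exact: le_convex_comb.
apply: le_trans (expR_ge1Dx _).
have dB i : `|c i - f| <= 2 * B.
  by apply: (le_trans (ler_normB _ _)); have := cB i; lra.
apply: (@le_trans _ _ (\sum_i (p i * (1 + 8 * l ^+ 2 * B ^+ 2) + l * (p i * c i - p i * f)))).
  apply: ler_sum => i _.
  apply: (@le_trans _ _ (p i * (1 + l * (c i - f) + 2 * (l * (c i - f)) ^+ 2))).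
    rewrite ler_wpM2l // expR_le_quadratic //.
    apply: le_trans (ler_norm _) _; rewrite normrM; apply: le_trans lB.
    exact: ler_wpM2l.
  have hsq : (l * (c i - f)) ^+ 2 <= 4 * l ^+ 2 * B ^+ 2.
    have -> : 4 * l ^+ 2 * B ^+ 2 = l ^+ 2 * (2 * B) ^+ 2 by ring.
    rewrite exprMn ler_wpM2l ?sqr_ge0 //.
    by rewrite -[leLHS]real_normK ?num_real // lerXn2r ?nnegrE // (le_trans _ (dB i)).
  by have := ler_wpM2l (p0 i) hsq; lra.
by rewrite big_split /= -mulr_suml p1 -mulr_sumr sumrB -mulr_suml p1 -/f; lra.
Qed.

Lemma sum_prod_weights (K : realType) (I : finType) (r : nat) (p : I -> K) :
  \sum_i p i = 1 -> \sum_(w : {ffun 'I_r -> I}) \prod_j p (w j) = 1.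
Proof.
by move=> p1; rewrite -(bigA_distr_bigA (fun _ i => p i)) big1.
Qed.

(** The left side is the probability that the mean of [r] independent draws from [p] deviates by at
    least [u], written as a finite sum over the outcomes [w]. A Chernoff bound is applied to each
    sign of the deviation. *)
Lemma maurey_tail (K : realType) (I : finType) (p c : I -> K) (B u : K) (r : nat) :
  (forall i, 0 <= p i) -> \sum_i p i = 1 -> (forall i, `|c i| <= B) ->
  0 < B -> 0 <= u <= 4 * B -> (0 < r)%N ->
  \sum_(w : {ffun 'I_r -> I}) (\prod_j p (w j)) *
    (u <= `|r%:R^-1 * \sum_j c (w j) - \sum_i p i * c i|)%R%:R
  <= 2 * expR (- (r%:R * u ^+ 2 / (32 * B ^+ 2))).
Proof.
move=> p0 p1 cB B0 /andP[u0 uB] r0; set f := \sum_i p i * c i.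
have r0' : 0 < r%:R :> K by rewrite ltr0n.
(* This value minimizes [8 l ^ 2 B ^ 2 - l u], with minimum [- u ^ 2 / (32 B ^ 2)]; the condition
   [u <= 4 B] keeps [2 l B] below 1/2. *)
pose l := u / (16 * B ^+ 2).
have B2 : 0 < 16 * B ^+ 2 by rewrite mulr_gt0 ?exprn_gt0.
have l0 : 0 <= l by rewrite divr_ge0 // ltW.
have lB : l * (2 * B) <= 1 / 2.
  rewrite /l mulrAC ler_pdivrMr //; nra.
pose e := expR (- (l * u * r%:R)).
pose S (w : {ffun 'I_r -> I}) := \sum_j (c (w j) - f).
pose pi w := \prod_(j < r) p ((w : {ffun 'I_r -> I}) j).
have pi0 w : 0 <= pi w by apply: prodr_ge0.
apply: (@le_trans _ _ (\sum_w (e * (pi w * expR (l * S w)) + e * (pi w * expR (- l * S w))))).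
  apply: ler_sum => w _; rewrite -/(pi w).
  rewrite [leRHS](_ : _ = pi w * (e * expR (l * S w) + e * expR (- l * S w))); last by ring.
  apply: ler_wpM2l => //; rewrite /e -!exp.expRD.
  have -> : r%:R^-1 * (\sum_j c (w j)) - f = r%:R^-1 * S w.
    rewrite /S sumrB sumr_const card_ord mulrBr -[f *+ r]mulr_natl mulKf //.
    by rewrite gt_eqF.
  rewrite normrM ger0_norm ?invr_ge0 ?(ltW r0') // ler_pdivlMl //.
  have [h|_] := leP (r%:R * u) `|S w|; last by rewrite mulr0n addr_ge0 ?expR_ge0.
  rewrite mulr1n.
  have [S0|S0] := leP 0 (S w).
    rewrite ger0_norm // in h.
    rewrite -[leLHS]addr0 lerD ?expR_ge0 // -[leLHS]exp.expR0 ler_expR; nra.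
  rewrite ltr0_norm // in h.
  rewrite -[leLHS]add0r lerD ?expR_ge0 // -[leLHS]exp.expR0 ler_expR; nra.
have mgf l' : `|l'| = l -> \sum_w pi w * expR (l' * S w) <= expR (8 * l ^+ 2 * B ^+ 2) ^+ r.
  move=> ll'.
  have -> : \sum_w pi w * expR (l' * S w) = (\sum_i p i * expR (l' * (c i - f))) ^+ r.
    rewrite -[X in _ ^+ X]card_ord -prodr_const.
    rewrite (bigA_distr_bigA (fun _ i => p i * expR (l' * (c i - f)))) /=.
    by apply: eq_bigr => w _; rewrite big_split /= -expR_sum -mulr_sumr.
  rewrite lerXn2r ?nnegrE ?expR_ge0 //.
    by apply: sumr_ge0 => i _; rewrite mulr_ge0 ?expR_ge0.
  have -> : l ^+ 2 = l' ^+ 2 by rewrite -ll' real_normK ?num_real.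
  by apply: mgf_convex_comb => //; rewrite ll'.
rewrite big_split /= -!mulr_sumr -mulrDr.
have h1 := mgf l (ger0_norm l0); have h2 := mgf (- l); rewrite normrN ger0_norm // in h2.
have {}h2 := h2 erefl.
apply: (@le_trans _ _ (e * (2 * expR (8 * l ^+ 2 * B ^+ 2) ^+ r))).
  by apply: ler_wpM2l; [exact: expR_ge0 | lra].
rewrite mulrCA -expRM_natl /e -exp.expRD ler_wpM2l // ler_expR.
rewrite le_eqVlt; apply/orP; left; apply/eqP; rewrite /l; field.
by rewrite gt_eqF.
Qed.

Lemma integral_sum_indic (K : realType) (d : measure_display) (T : measurableType d)
    (mu : probability T K) (I : finType) (c : I -> K) (A : I -> set T) :
  (forall i, 0 <= c i) -> (forall i, measurable (A i)) ->
  (\int[mu]_x (\sum_i c i * \1_(A i) x)%:E)%E = (\sum_i c i * fine (mu (A i)))%:E.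
Proof.
move=> c0 mA.
under eq_integral do rewrite -sumEFin.
have mi i : measurable_fun setT (fun x => (c i * \1_(A i) x)%:E : \bar K).
  by apply/measurable_EFinP; apply: measurable_funM => //.
rewrite ge0_integral_sum //; last first.
  by move=> i x _; rewrite lee_fin mulr_ge0.
rewrite -sumEFin; apply: eq_bigr => i _.
under eq_integral do rewrite EFinM.
rewrite ge0_integralZl ?lee_fin //; last by apply/measurable_EFinP.
by rewrite integral_indic // setIT EFinM fineK // fin_num_measure.
Qed.

(** First moment argument: averaged over random [w], the measure of [E] plus its empirical frequency
    is at most [4 * expR _ < e], so a single [w] makes both small. This [w] may depend on the sample
    [x] and on [p]. *)
Lemma maurey_approximation (K : realType) (d : measure_display) (T : measurableType d)
    (mu : probability T K) (I : finType) (p : I -> K) (c : I -> T -> K)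
    (m r : nat) (x : 'I_m -> T) (B u e : K) :
  (forall i, 0 <= p i) -> \sum_i p i = 1 ->
  (forall i, measurable_fun setT (c i)) -> (forall i y, `|c i y| <= B) ->
  0 < B -> 0 <= u <= 4 * B -> (0 < r)%N -> (0 < m)%N ->
  4 * expR (- (r%:R * u ^+ 2 / (32 * B ^+ 2))) < e ->
  exists w : {ffun 'I_r -> I},
    let E := [set y | u <= `|r%:R^-1 * \sum_j c (w j) y - \sum_i p i * c i y|] in
    [/\ measurable E, fine (mu E) <= e & \sum_(j < m) \1_E (x j) <= m%:R * e].
Proof.
move=> p0 p1 mc cB B0 uB r0 m0 he.
pose E (w : {ffun 'I_r -> I}) :=
  [set y | u <= `|r%:R^-1 * \sum_j c (w j) y - \sum_i p i * c i y|].
pose pi w := \prod_(j < r) p ((w : {ffun 'I_r -> I}) j).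
have pi0 w : 0 <= pi w by apply: prodr_ge0.
have m0' : 0 < m%:R :> K by rewrite ltr0n.
have mE w : measurable (E w).
  rewrite /E -[X in measurable X]setTI.
  apply: measurable_fun_le => //.
  apply: measurableT_comp => //; apply: measurable_funB.
    by apply: measurable_funM => //; apply: measurable_sum.
  by apply: measurable_sum => i; apply: measurable_funM.
set q := expR _ in he.
have tail y : \sum_w pi w * \1_(E w) y <= 2 * q.
  apply: le_trans (maurey_tail p0 p1 (fun i => cB i y) B0 uB r0).
  apply: ler_sum => w _; rewrite indicE /pi ler_wpM2l ?prodr_ge0 //.
  rewrite ler_nat; case: (boolP (y \in E w)) => //.
  by rewrite inE /E /= => ->.
have tail_mu : \sum_w pi w * fine (mu (E w)) <= 2 * q.
  rewrite -lee_fin -integral_sum_indic //.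
  apply: (@le_trans _ _ (\int[mu]_x (2 * q)%:E)%E).
    apply: ge0_le_integral => //.
    - by move=> y _; rewrite lee_fin sumr_ge0 // => w _; rewrite mulr_ge0.
    - apply/measurable_EFinP; apply: measurable_sum => w.
      by apply: measurable_funM => //.
    - by move=> y _; rewrite lee_fin.
  rewrite integral_cst //.
  by rewrite [X in (_ * X)%E](_ : _ = 1%E) ?mule1 //; exact: probability_setT.
have tail_emp : \sum_w pi w * (m%:R^-1 * \sum_(j < m) \1_(E w) (x j)) <= 2 * q.
  under eq_bigr do rewrite mulrCA mulr_sumr.
  rewrite -mulr_sumr exchange_big /= ler_pdivrMl //.
  rewrite [m%:R * _]mulr_natl -[X in _ *+ X]card_ord -sumr_const; apply: ler_sum => j _; exact: tail.
apply: contrapT => noW.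
have : e <= \sum_w pi w * (fine (mu (E w)) + m%:R^-1 * \sum_(j < m) \1_(E w) (x j)).
  have {1}-> : e = \sum_w pi w * e by rewrite -mulr_suml (sum_prod_weights r p1) mul1r.
  apply: ler_sum => w _.
  apply: (ler_wpM2l (pi0 w)); rewrite leNgt; apply/negP => lt; apply: noW; exists w => /=.
  have f0 : 0 <= fine (mu (E w)) by apply: fine_ge0.
  have i0 : 0 <= \sum_(j < m) \1_(E w) (x j) :> K by apply: sumr_ge0.
  split; first exact: mE.
    by apply: ltW; apply: (le_lt_trans _ lt); rewrite lerDl;
      apply: mulr_ge0; [rewrite invr_ge0 ltW | exact: i0].
  rewrite -ler_pdivrMl //; apply: ltW; apply: (le_lt_trans _ lt).
  rewrite lerDr; exact: f0.
under eq_bigr do rewrite mulrDr.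
rewrite big_split /=; lra.
Qed.

(** * Energy lower bound for convex hulls of bounded functions *)

Lemma dyadic_sum_le (K : realType) (B : K) (t : nat) :
  \sum_(i < t) (B / 2 ^+ i) ^+ 2 <= 4 / 3 * B ^+ 2.
Proof.
elim: t B => [|t IH] B; first by rewrite big_ord0 mulr_ge0 ?sqr_ge0.
rewrite big_ord_recl expr0 divr1.
have {IH} := IH (B / 2).
under eq_bigr do rewrite -mulrA -invfM -exprS.
rewrite /= !exprMn => h; apply: (le_trans (lerD (lexx _) h)).
by rewrite exprVn; lra.
Qed.

(** The levels at or below [|y|] form a geometric series of ratio 1/4 whose top term is at most
    [y ^ 2]. The induction discards the levels above [|y|] one by one. *)
Lemma layer_cake_le (K : realType) (B y : K) (t : nat) : 0 <= B ->
  \sum_(i < t) (B / 2 ^+ i) ^+ 2 * (B / 2 ^+ i <= `|y|)%R%:R <= 4 / 3 * y ^+ 2.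
Proof.
elim: t B => [|t IH] B B0; first by rewrite big_ord0 mulr_ge0 ?sqr_ge0.
have [By|yB] := leP B `|y|.
  apply: (@le_trans _ _ (4 / 3 * B ^+ 2)).
    apply: le_trans (dyadic_sum_le B t.+1); apply: ler_sum => i _.
    by rewrite ler_piMr ?sqr_ge0 // lern1 leq_b1.
  rewrite ler_wpM2l // -[leRHS]real_normK ?num_real //.
  by rewrite lerXn2r ?nnegrE.
rewrite big_ord_recl expr0 divr1 (leNgt B) yB mulr0 add0r.
have := IH (B / 2); rewrite divr_ge0 // => /(_ isT).
by under eq_bigr do rewrite -mulrA -invfM -exprS.
Qed.

(** At the first level with [2 * (B / 2 ^ i) <= |y|], the value [|y|] is at most four times
    [B / 2 ^ i]; if there is none, the last term covers [y ^ 2]. Thresholds are doubled compared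
    with [layer_cake_le] to leave room for the approximation error. *)
Lemma layer_cake_ge (K : realType) (B y : K) (t : nat) : `|y| <= B ->
  y ^+ 2 <= 16 * (\sum_(i < t) (B / 2 ^+ i) ^+ 2 * (2 * (B / 2 ^+ i) <= `|y|)%R%:R)
            + 16 * (B / 2 ^+ t) ^+ 2.
Proof.
move=> yB; have B0 : 0 <= B by apply: le_trans yB.
elim: t => [|t IH].
  rewrite big_ord0 expr0 divr1 mulr0 add0r -[leLHS]real_normK ?num_real //.
  have : `|y| ^+ 2 <= B ^+ 2 by rewrite lerXn2r ?nnegrE.
  by have := sqr_ge0 B; lra.
rewrite big_ord_recr /=; set z := B / 2 ^+ t in IH *.
have z0 : 0 <= z by rewrite divr_ge0 ?exprn_ge0.
have -> : B / 2 ^+ t.+1 = z / 2 by rewrite exprSr invfM mulrA.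
have [h|h] := leP (2 * z) `|y|.
  by rewrite mulr1n mulr1; have := sqr_ge0 (z / 2); lra.
have : y ^+ 2 <= 16 * (z / 2) ^+ 2.
  rewrite -[leLHS]real_normK ?num_real //.
  have -> : 16 * (z / 2) ^+ 2 = (2 * z) ^+ 2 by field.
  by rewrite lerXn2r ?nnegrE ?mulr_ge0 // ltW.
have : 0 <= \sum_(i < t) (B / 2 ^+ i) ^+ 2 * (2 * (B / 2 ^+ i) <= `|y|)%R%:R.
  by apply: sumr_ge0 => i _; rewrite mulr_ge0 ?sqr_ge0.
rewrite mulr0n mulr0 addr0; lra.
Qed.

Lemma fine_measureU_le (d : measure_display) (T : measurableType d) (K : realType)
    (mu : probability T K) (F A E : set T) :
  measurable F -> measurable A -> measurable E -> F `<=` A `|` E ->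
  fine (mu F) <= fine (mu A) + fine (mu E).
Proof.
move=> mF mA mE FAE; rewrite -lee_fin EFinD !fineK ?fin_num_measure //.
apply: le_trans (measureU2 _ mA mE).
by apply: le_measure => //; rewrite inE //; exact: measurableU.
Qed.

(** The term [4 ^ i / t] pays for the number of averages at level [i], whose logarithm grows like
    [4 ^ i]; the term 1 leaves a small failure probability after the union bound. *)
Definition deviation (K : realType) (B : K) (t i : nat) : K :=
  (1 + 4 ^+ i / t%:R) / (40 * 40 * B ^+ 2).

Definition average (K : realType) (T : Type) (I : finType) (r : nat) (c : I -> T -> K)
    (w : {ffun 'I_r -> I}) (y : T) : K :=
  r%:R^-1 * \sum_j c (w j) y.

Definition superlevel (K : realType) (T : Type) (f : T -> K) (a : K) : set T :=
  [set y | a <= `|f y|].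

Lemma measurable_superlevel (d : measure_display) (T : measurableType d) (K : realType)
    (f : T -> K) (a : K) : measurable_fun setT f -> measurable (superlevel f a).
Proof.
move=> mf; rewrite /superlevel -[X in measurable X]setTI.
by apply: measurable_fun_le => //; exact: measurableT_comp.
Qed.

Lemma measurable_convex_comb (d : measure_display) (T : measurableType d) (K : realType)
    (I : finType) (p : I -> K) (c : I -> T -> K) :
  (forall i, measurable_fun setT (c i)) ->
  measurable_fun setT (fun y => \sum_i p i * c i y).
Proof. by move=> mc; apply: measurable_sum => i; apply: measurable_funM. Qed.

Lemma measurable_average (d : measure_display) (T : measurableType d) (K : realType)
    (I : finType) (r : nat) (c : I -> T -> K) (w : {ffun 'I_r -> I}) :
  (forall i, measurable_fun setT (c i)) -> measurable_fun setT (average c w).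
Proof. by move=> mc; apply: measurable_funM => //; apply: measurable_sum. Qed.

Lemma integral_sqr_layer_cake (d : measure_display) (T : measurableType d) (K : realType)
    (mu : probability T K) (f : T -> K) (B : K) (t : nat) :
  measurable_fun setT f -> (forall y, `|f y| <= B) ->
  (\int[mu]_y (f y ^+ 2)%:E <=
   (16 * (\sum_(i < t) (B / 2 ^+ i) ^+ 2 * fine (mu (superlevel f (2 * (B / 2 ^+ i)))))
    + 16 * (B / 2 ^+ t) ^+ 2)%:E)%E.
Proof.
move=> mf fB.
(* The constant remainder is treated as an extra level [t] whose set is the whole space, so that the
   bound is a single sum of indicators. *)
pose A (i : 'I_t.+1) := if (i < t)%N then superlevel f (2 * (B / 2 ^+ i)) else setT.
pose a (i : 'I_t.+1) := 16 * (B / 2 ^+ i) ^+ 2.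
have a0 i : 0 <= a i by rewrite mulr_ge0 ?sqr_ge0.
have mA i : measurable (A i).
  by rewrite /A; case: ifP => // _; exact: measurable_superlevel.
have Ai (i : 'I_t) : A (widen_ord (leqnSn t) i) = superlevel f (2 * (B / 2 ^+ i)).
  by rewrite /A /= ltn_ord.
have AT : A ord_max = setT by rewrite /A ltnn.
have -> : 16 * (\sum_(i < t) (B / 2 ^+ i) ^+ 2 *
    fine (mu (superlevel f (2 * (B / 2 ^+ i))))) + 16 * (B / 2 ^+ t) ^+ 2 =
    \sum_i a i * fine (mu (A i)).
  rewrite big_ord_recr /= AT probability_setT mulr1; congr (_ + _).
  rewrite mulr_sumr; apply: eq_bigr => i _.
  by rewrite /a /A /= ltn_ord mulrA.
rewrite -integral_sum_indic //; apply: ge0_le_integral => //.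
- by move=> y _; rewrite lee_fin sqr_ge0.
- by apply/measurable_EFinP; apply: measurable_funX.
- apply/measurable_EFinP; apply: measurable_sum => i.
  by apply: measurable_funM.
move=> y _; rewrite lee_fin; apply: (le_trans (layer_cake_ge t (fB y))).
have T1 : \1_[set: T] y = 1 :> K by rewrite indicE in_setT.
rewrite big_ord_recr AT T1 mulr1 lerD2r mulr_sumr; apply: ler_sum => i _.
rewrite Ai indicE mulrA; apply: ler_wpM2l; first exact: (a0 (widen_ord (leqnSn t) i)).
rewrite ler_nat.
by have [h|//] := leP (2 * (B / 2 ^+ i)) `|f y|; rewrite mem_set.
Qed.

Lemma expr4_sqr (K : realType) (i : nat) : 4 ^+ i = (2 ^+ i) ^+ 2 :> K.
Proof. by rewrite -exprM mulnC exprM; congr (_ ^+ _); ring. Qed.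

(** With [E] the set where the average misses [f] by at least [tau / 2], one has the inclusions of
    [{|f| >= 2 tau}] in [{|average| >= 3/2 tau}] or [E], used for [mu], and of
    [{|average| >= 3/2 tau}] in [{|f| >= tau}] or [E], used for the sample. The two uses of [E] cost
    [e / 4] and [e]. *)
Lemma level_count_ge (d : measure_display) (T : measurableType d) (K : realType)
    (mu : probability T K) (I : finType) (p : I -> K) (c : I -> T -> K)
    (m i rho : nat) (x : 'I_m -> T) (B e eta : K) :
  (forall k, measurable_fun setT (c k)) -> (forall k y, `|c k y| <= B) ->
  (0 < m)%N -> (0 < rho)%N -> 0 < B ->
  4 * expR (- (rho%:R / 128)) < e ->
  (forall w : {ffun 'I_(rho * 4 ^ i) -> I},
     let A := superlevel (average c w) (3 / 2 * (B / 2 ^+ i)) in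
     m%:R * (fine (mu A) / 4 - eta) <= \sum_(j < m) \1_A (x j)) ->
  (forall k, 0 <= p k) -> \sum_k p k = 1 ->
  m%:R * (fine (mu (superlevel (fun y => \sum_k p k * c k y) (2 * (B / 2 ^+ i)))) / 4
          - eta - 5 / 4 * e) <=
  \sum_(j < m) (B / 2 ^+ i <= `|\sum_k p k * c k (x j)|)%R%:R.
Proof.
move=> mc cB m0 rho0 B0 rhoe good p0 p1.
pose f y := \sum_k p k * c k y; rewrite -/f.
have -> : \sum_(j < m) (B / 2 ^+ i <= `|\sum_k p k * c k (x j)|)%R%:R =
  \sum_(j < m) (B / 2 ^+ i <= `|f (x j)|)%R%:R :> K by [].
set tau := B / 2 ^+ i.
have i0 : 0 < 2 ^+ i :> K by rewrite exprn_gt0.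
have tau0 : 0 < tau by rewrite divr_gt0.
have tauB : tau <= B by rewrite ler_pdivrMr // ler_peMr ?(ltW B0) // exprn_ege1 // ler1n.
have r0 : (0 < rho * 4 ^ i)%N by rewrite muln_gt0 rho0 expn_gt0.
have uB : 0 <= tau / 2 <= 4 * B by apply/andP; split; lra.
(* The factor [4 ^ i] in the number of draws cancels the one in [tau ^ 2], so the exponent is the
   same at all levels. *)
have he : 4 * expR (- ((rho * 4 ^ i)%:R * (tau / 2) ^+ 2 / (32 * B ^+ 2))) < e.
  rewrite (_ : _ / _ = rho%:R / 128) // natrM natrX expr4_sqr /tau.
  by field; rewrite (gt_eqF B0) (gt_eqF i0).
have [w] := maurey_approximation mu x p0 p1 mc cB B0 uB r0 m0 he.
set E := [set y | _] => -[mE muE empE].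
set A := superlevel (average c w) (3 / 2 * tau).
have mf : measurable_fun setT f by exact: measurable_convex_comb.
have mA : measurable A by apply: measurable_superlevel; exact: measurable_average.
have FAE : superlevel f (2 * tau) `<=` A `|` E.
  move=> y /= hy; have [h|h] := leP (tau / 2) `|average c w y - f y|; first by right.
  left; rewrite /A /superlevel /=.
  have : `|f y| <= `|average c w y| + `|average c w y - f y|.
    by rewrite -{1}[f y](subKr (average c w y)); exact: ler_normB.
  move: hy; rewrite /superlevel /=; lra.
have hmu := fine_measureU_le mu (measurable_superlevel (2 * tau) mf) mA mE FAE.
have {good} /= hA := good w; rewrite -/tau -/A in hA.
have cnt : \sum_(j < m) \1_A (x j) <=
    \sum_(j < m) (tau <= `|f (x j)|)%R%:R + \sum_(j < m) \1_E (x j) :> K.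
  rewrite -big_split; apply: ler_sum => j _ /=.
  have [h|h] := leP tau `|f (x j)|.
    rewrite indicE; apply: (@le_trans _ _ (1 + 0)); first by rewrite addr0 lern1 leq_b1.
    by rewrite lerD.
  rewrite mulr0n add0r !indicE ler_nat.
  case: (boolP (x j \in A)) => //; rewrite inE => hA'.
  rewrite mem_set // /E /= -/(average c w (x j)) -/(f (x j)).
  have : `|average c w (x j)| <= `|f (x j)| + `|average c w (x j) - f (x j)|.
    by rewrite -{1}[average c w (x j)](subrKC (f (x j))); exact: ler_normD.
  by move: hA'; rewrite /A /superlevel /=; lra.
have m0' : 0 < m%:R :> K by rewrite ltr0n.
have : m%:R * (fine (mu (superlevel f (2 * tau))) / 4 - eta - 5 / 4 * e) <=
    m%:R * (fine (mu A) / 4 - eta) - m%:R * e.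
  by rewrite -mulrBr ler_pM2l //; lra.
move: hA cnt empE; set SA := \sum_(j < m) \1_A _; set SE := \sum_(j < m) \1_E _.
set S := \sum_(j < m) _; lra.
Qed.

(** Since [(B / 2 ^ i) ^ 2 * 4 ^ i = B ^ 2], the second term of [deviation] costs [B ^ 2 / t] at
    each of the [t] levels; [7 / 3] is [4 / 3 + 1]. *)
Lemma sum_level_deviation_le (K : realType) (B : K) (t : nat) : 0 < B ->
  \sum_(i < t) (B / 2 ^+ i) ^+ 2 * deviation B t i <= 7 / 3 / (40 * 40).
Proof.
move=> B0; have BN : B != 0 by rewrite gt_eqF.
have -> : \sum_(i < t) (B / 2 ^+ i) ^+ 2 * deviation B t i =
    (40 * 40 * B ^+ 2)^-1 * (\sum_(i < t) (B / 2 ^+ i) ^+ 2 + \sum_(i < t) B ^+ 2 / t%:R).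
  rewrite -big_split mulr_sumr; apply: eq_bigr => i _ /=.
  have t0 : t%:R != 0 :> K by rewrite pnatr_eq0 -lt0n (leq_ltn_trans _ (ltn_ord i)).
  rewrite /deviation expr4_sqr; field.
  by rewrite BN t0 expf_neq0 // pnatr_eq0.
have B2 : 0 < 40 * 40 * B ^+ 2 by rewrite mulr_gt0 ?exprn_gt0.
rewrite ler_pdivrMl // sumr_const card_ord.
have : (B ^+ 2 / t%:R) *+ t <= B ^+ 2.
  case: t => [|t]; first by rewrite mulr0n sqr_ge0.
  by rewrite -[leLHS]mulr_natr divfK // pnatr_eq0.
have := dyadic_sum_le B t; have := sqr_ge0 B; lra.
Qed.

Lemma empirical_energy_ge (d : measure_display) (T : measurableType d) (K : realType)
    (mu : probability T K) (I : finType) (p : I -> K) (c : I -> T -> K)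
    (m t rho : nat) (x : 'I_m -> T) (B : K) :
  (forall k, measurable_fun setT (c k)) -> (forall k y, `|c k y| <= B) ->
  (0 < m)%N -> (0 < rho)%N -> 0 < B -> 32 * B ^+ 2 <= 4 ^+ t ->
  4 * expR (- (rho%:R / 128)) < (40 * 40 * B ^+ 2)^-1 ->
  (forall (i : 'I_t) (w : {ffun 'I_(rho * 4 ^ i) -> I}),
     let A := superlevel (average c w) (3 / 2 * (B / 2 ^+ i)) in
     m%:R * (fine (mu A) / 4 - deviation B t i) <= \sum_(j < m) \1_A (x j)) ->
  (forall k, 0 <= p k) -> \sum_k p k = 1 ->
  (1 <= \int[mu]_y ((\sum_k p k * c k y) ^+ 2)%:E)%E ->
  m%:R / 400 <= \sum_(j < m) (\sum_k p k * c k (x j)) ^+ 2.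
Proof.
move=> mc cB m0 rho0 B0 tB rhoe good p0 p1.
set f := fun y => \sum_k p k * c k y => int1.
have mf : measurable_fun setT f by exact: measurable_convex_comb.
have fB y : `|f y| <= B by exact: le_convex_comb.
set e := (40 * 40 * B ^+ 2)^-1 in rhoe.
pose tau (i : nat) := B / 2 ^+ i.
pose a (i : 'I_t) := fine (mu (superlevel f (2 * tau i))).
have m0' : 0 < m%:R :> K by rewrite ltr0n.
have B2 : 0 < B ^+ 2 by rewrite exprn_gt0.
(* The hypothesis [32 * B ^ 2 <= 4 ^ t] makes the truncation term at most 1/2, leaving half of the
   energy for the levels. *)
have energy : 1 / 32 <= \sum_(i < t) tau i ^+ 2 * a i.
  have := le_trans int1 (integral_sqr_layer_cake mu t mf fB); rewrite lee_fin -/(tau t).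
  have : tau t ^+ 2 <= 1 / 32.
    by rewrite /tau expr_div_n -expr4_sqr ler_pdivrMr ?exprn_gt0 //; lra.
  rewrite /a /tau; lra.
have lev (i : 'I_t) := level_count_ge mc cB m0 rho0 B0 rhoe (good i) p0 p1.
have main : m%:R * (\sum_(i < t) tau i ^+ 2 * (a i / 4 - deviation B t i - 5 / 4 * e)) <=
    4 / 3 * \sum_(j < m) f (x j) ^+ 2.
  apply: (@le_trans _ _ (\sum_(i < t) tau i ^+ 2 * \sum_(j < m) (tau i <= `|f (x j)|)%R%:R)).
    rewrite mulr_sumr; apply: ler_sum => i _; rewrite mulrCA.
    apply: ler_wpM2l; [exact: sqr_ge0 | exact: (lev i)].
  under eq_bigr do rewrite mulr_sumr.
  rewrite exchange_big mulr_sumr; apply: ler_sum => j _.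
  exact: layer_cake_le (ltW B0).
(* The levels give at least [1 / 128]; the deviations and the approximation errors remove at most
   [7 / 3 / 1600 + 5 / 3 / 1600 = 1 / 400]. *)
have num : 4 / 3 / 400 <= \sum_(i < t) tau i ^+ 2 * (a i / 4 - deviation B t i - 5 / 4 * e).
  under eq_bigr do rewrite !mulrBr.
  rewrite !sumrB -mulr_suml.
  have -> : \sum_(i < t) tau i ^+ 2 * (a i / 4) = (\sum_(i < t) tau i ^+ 2 * a i) / 4.
    by rewrite mulr_suml; apply: eq_bigr => i _; rewrite mulrA.
  have := sum_level_deviation_le t B0.
  have : (\sum_(i < t) tau i ^+ 2) * (5 / 4 * e) <= 5 / 3 / (40 * 40).
    apply: (@le_trans _ _ (4 / 3 * B ^+ 2 * (5 / 4 * e))).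
      apply: ler_wpM2r (dyadic_sum_le B t).
      by rewrite mulr_ge0 // invr_ge0 mulr_ge0 ?sqr_ge0.
    rewrite le_eqVlt; apply/orP; left; apply/eqP; rewrite /e; field.
    exact: lt0r_neq0.
  by rewrite -/(tau _); lra.
have := ler_wpM2l (ltW m0') num; lra.
Qed.

(** The bad event concerns only the finitely many averages, not the weights [p], so one union bound
    serves all convex combinations simultaneously. *)
Lemma convex_hull_energy (d : measure_display) (T : measurableType d) (P : probability T R)
    (mu : probability Rm R) (m t rho : nat) (X : 'I_m -> T -> Rm)
    (I : finType) (c : I -> Rm -> R) (B : R) :
  (forall j, measurable_fun setT (X j)) -> mutually_independent P X ->
  (forall j (A : set Rm), measurable A -> P (X j @^-1` A) = mu A) ->
  (forall k, measurable_fun setT (c k : Rm -> Rm)) -> (forall k y, `|c k y| <= B) ->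
  (0 < m)%N -> (0 < rho)%N -> 0 < B -> 32 * B ^+ 2 <= 4 ^+ t ->
  4 * expR (- (rho%:R / 128)) < (40 * 40 * B ^+ 2)^-1 ->
  exists G : set T, [/\ measurable G,
    ((1 - \sum_(i < t) (#|I| ^ (rho * 4 ^ i))%:R * expR (- (m%:R * deviation B t i)))%:E
       <= P G)%E &
    forall s, G s -> forall p : I -> R, (forall k, 0 <= p k) -> \sum_k p k = 1 ->
      (1 <= \int[mu]_y ((\sum_k p k * c k y) ^+ 2)%:E)%E ->
      m%:R / 400 <= \sum_(j < m) (\sum_k p k * c k (X j s)) ^+ 2].
Proof.
move=> mX iX lX mc cB m0 rho0 B0 tB rhoe.
pose A (i : 'I_t) (w : {ffun 'I_(rho * 4 ^ i) -> I}) :=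
  superlevel (average c w) (3 / 2 * (B / 2 ^+ i)).
have mA i w : measurable (A i w) by apply: measurable_superlevel; exact: measurable_average.
pose bad i w := [set s | \sum_(j < m) \1_(A i w) (X j s) <
  m%:R * (fine (mu (A i w)) / 4 - deviation B t i)].
have badP i w : measurable (bad i w) /\
    (P (bad i w) <= (expR (- (m%:R * deviation B t i)))%:E)%E.
  apply: chernoff_lower_tail => //.
    by move=> j; rewrite lX // fineK // fin_num_measure.
  rewrite fine_ge0 //= -lee_fin fineK ?fin_num_measure //.
  exact: probability_le1.
have bad_i i := measure_finite_union_le (fun w => (badP i w).1) (fun w => (badP i w).2).
have [mbad Pbad] := measure_finite_union_le (fun i => (bad_i i).1) (fun i => (bad_i i).2).
set Bad := [set s | _] in mbad Pbad.
exists (~` Bad); split; first exact: measurableC.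
  rewrite probability_setC // EFinB; apply: leeB => //.
  apply: (le_trans Pbad); rewrite lee_fin; apply: ler_sum => i _.
  by rewrite sumr_const card_ffun card_ord -[leLHS]mulr_natl.
move=> s nbad p p0 p1 int1.
apply: (empirical_energy_ge mc cB m0 rho0 B0 tB rhoe _ p0 p1 int1) => i w /=.
rewrite leNgt; apply/negP => h; apply: nbad.
by exists i, w.
Qed.

(** * Orthogonality of Legendre polynomials *)

Section RodriguesPolynomial.
Variable n : nat.

Let W : {poly R} := ('X ^+ 2 - 1) ^+ n.

Let deriv_nat (j : nat) : (j%:R : {poly R})^`() = 0.
Proof. by rewrite -polyC_natr derivC. Qed.

Let deriv_base : ('X ^+ 2 - 1 : {poly R})^`() = 2 * 'X.
Proof. by rewrite derivB derivXn (deriv_nat 1) subr0 expr1 mulr_natl. Qed.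

(** Differentiate [(x ^ 2 - 1) W' = 2 n x W] exactly [k + 1] times. *)
Lemma derivn_rodrigues_rec (k : nat) :
  ('X ^+ 2 - 1) * W^`(k.+2) =
  2 * (n%:R - k%:R - 1) * 'X * W^`(k.+1) + (k%:R + 1) * (2 * n%:R - k%:R) * W^`(k).
Proof.
have d1 : ('X ^+ 2 - 1) * W^`() = 2 * n%:R * 'X * W.
  rewrite /W; case: n => [|j]; first by rewrite expr0 (deriv_nat 1) !mulr0 !mul0r.
  rewrite deriv_exp deriv_base /= [RHS]/= -[(_ * _) *+ j.+1]mulr_natl.
  by set b := 'X ^+ 2 - 1; rewrite (exprS b); ring.
elim: k => [|k IH].
  have := congr1 deriv d1; rewrite !derivM !deriv_nat deriv_base derivX.
  rewrite derivn0 derivn1 derivnS derivn1 => h.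
  rewrite -[LHS](addrK (2 * 'X * W^`())) [_ + 2 * 'X * _]addrC h; ring.
have := congr1 deriv IH.
rewrite derivD !derivM deriv_base !derivB !derivD !derivM !deriv_nat (deriv_nat 1) derivX.
rewrite -!derivnS => h.
rewrite -[LHS](addrK (2 * 'X * W^`(k.+2))) [_ + 2 * 'X * _]addrC h -[k.+1%:R]natr1; ring.
Qed.


(** Each derivative removes at most one factor [p]. For [p = x ^ 2 - 1] this makes the boundary
    terms vanish in the integrations by parts. *)
Lemma derivn_exp_factor (p : {poly R}) (j : nat) : (j <= n)%N ->
  exists q, (p ^+ n)^`(j) = p ^+ (n - j) * q.
Proof.
elim: j => [|j IH] jn; first by exists 1; rewrite derivn0 subn0 mulr1.
have [q hq] := IH (ltnW jn).
exists ((n - j)%:R * p^`() * q + p * q^`()).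
rewrite derivnS hq derivM deriv_exp -(subnSK jn) /= -mulr_natl exprS; ring.
Qed.

Lemma derivn_rodrigues_boundary (j : nat) (x : R) : x ^+ 2 = 1 -> (j < n)%N ->
  (W^`(j)).[x] = 0.
Proof.
move=> x1 jn; have [q ->] := derivn_exp_factor ('X ^+ 2 - 1) (ltnW jn).
by rewrite -(subnSK jn) hornerM horner_exp !hornerE x1 subrr expr0n mul0r.
Qed.

Lemma rodrigues_monic : W \is monic.
Proof. by rewrite monic_exp // -polyC1 monicXnsubC. Qed.

Lemma size_rodrigues : size W = (2 * n).+1.
Proof.
have := size_exp ('X ^+ 2 - 1%:P : {poly R}) n; rewrite size_XnsubC //= => <-.
by rewrite polyC1 prednK // size_poly_gt0 monic_neq0 // rodrigues_monic.
Qed.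

Lemma derivn_rodrigues_top : W^`(2 * n) = ((2 * n)`!)%:R.
Proof.
rewrite -polyC_natr; apply/polyP => i; rewrite coef_derivn coefC.
have := rodrigues_monic; rewrite monicE lead_coefE size_rodrigues /= => /eqP h.
case: i => [|i] /=; first by rewrite addn0 h ffactnn.
by rewrite nth_default ?mul0rn // size_rodrigues -addSnnS leq_addr.
Qed.

End RodriguesPolynomial.

(** * Algebraic integration over [-1, 1] and Legendre orthogonality *)

Definition poly_antideriv (p : {poly R}) : {poly R} :=
  \poly_(i < (size p).+1) (p`_i.-1 / i%:R).

Lemma deriv_poly_antideriv (p : {poly R}) : (poly_antideriv p)^`() = p.
Proof.
apply/polyP => i; rewrite coef_deriv coef_poly ltnS.
case: ltnP => [_|h]; last by rewrite mul0rn nth_default.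
by rewrite -[LHS]mulr_natr divfK // pnatr_eq0.
Qed.

(** Working with an algebraic integral keeps orthogonality within polynomial identities;
    [integral_deriv_poly] links it to the Lebesgue integral. *)
Definition poly_integral (p : {poly R}) : R :=
  (poly_antideriv p).[1] - (poly_antideriv p).[-1].

Lemma poly_integralE (q p : {poly R}) : q^`() = p -> poly_integral p = q.[1] - q.[-1].
Proof.
move=> qp; rewrite /poly_integral; set a := poly_antideriv p.
have ap : a^`() = p by exact: deriv_poly_antideriv.
have : (size (a - q)%R <= 1)%N.
  apply/leq_sizeP => i; case: i => // i _.
  have d0 : (a - q)^`() = 0 by rewrite derivB ap qp subrr.
  have := coef_deriv (a - q) i; rewrite d0 coef0 -[RHS]mulr_natr => /esym/eqP.
  by rewrite mulf_eq0 pnatr_eq0 orbF => /eqP.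
move=> /size1_polyC /eqP; rewrite subr_eq => /eqP ->.
by rewrite !hornerE; ring.
Qed.

Lemma poly_integral_deriv (q : {poly R}) : poly_integral q^`() = q.[1] - q.[-1].
Proof. exact: poly_integralE. Qed.

Lemma poly_integralD (p q : {poly R}) :
  poly_integral (p + q) = poly_integral p + poly_integral q.
Proof.
rewrite -(deriv_poly_antideriv p) -(deriv_poly_antideriv q).
by rewrite -derivD !poly_integral_deriv !hornerD; ring.
Qed.

Lemma poly_integralZ (c : R) (p : {poly R}) :
  poly_integral (c *: p) = c * poly_integral p.
Proof.
rewrite -(deriv_poly_antideriv p).
by rewrite -derivZ !poly_integral_deriv !hornerZ; ring.
Qed.

Lemma poly_integral_sum (I : finType) (p : I -> {poly R}) :
  poly_integral (\sum_i p i) = \sum_i poly_integral (p i).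
Proof.
apply: (big_morph poly_integral poly_integralD).
by rewrite -(scale0r 0) poly_integralZ mul0r.
Qed.

Lemma poly_integral_by_parts (p q : {poly R}) : p.[1] = 0 -> p.[-1] = 0 ->
  poly_integral (p^`() * q) = - poly_integral (p * q^`()).
Proof.
move=> p1 pN1; apply/eqP; rewrite -addr_eq0 -poly_integralD -derivM.
by rewrite poly_integral_deriv !hornerM p1 pN1 !mul0r subrr.
Qed.

Lemma poly_integral_derivn_rodrigues (n j : nat) (q : {poly R}) : (j <= n)%N ->
  poly_integral ((('X ^+ 2 - 1) ^+ n)^`(j) * q) =
  (-1) ^+ j * poly_integral (('X ^+ 2 - 1) ^+ n * q^`(j)).
Proof.
elim: j q => [|j IH] q jn; first by rewrite !derivn0 expr0 mul1r.
rewrite derivnS poly_integral_by_parts ?derivn_rodrigues_boundary ?sqrrN ?expr1n //.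
by rewrite IH ?(ltnW jn) // -derivSn (exprS (-1)); ring.
Qed.

(** The derivative of [x b ^ (n + 1)] integrates to zero and equals
    [(2 n + 3) b ^ (n + 1) + (2 n + 2) b ^ n], which gives a recurrence in [n]. The factor
    [(-1) ^ n (2 n)!] is what [n] integrations by parts produce in the norm of [legendreP n]. *)
Lemma poly_integral_rodrigues (n : nat) :
  (-1) ^+ n * ((2 * n)`!)%:R * poly_integral (('X ^+ 2 - 1) ^+ n) =
  2 / (2 * n%:R + 1) * (2 ^+ n * (n`!)%:R) ^+ 2.
Proof.
elim: n => [|n IH].
  rewrite muln0 !fact0 !expr0 (@poly_integralE 'X) ?derivX // !hornerX.
  by rewrite mulr0 add0r divr1; ring.
set b := 'X ^+ 2 - 1 in IH *.
have rec : (2 * n%:R + 3) * poly_integral (b ^+ n.+1) =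
    - (2 * n%:R + 2) * poly_integral (b ^+ n).
  have : poly_integral ('X * b ^+ n.+1)^`() = 0.
    rewrite poly_integral_deriv !hornerM !horner_exp !hornerE.
    by rewrite sqrrN expr1n subrr !expr0n /= !mulr0 subrr.
  have -> : ('X * b ^+ n.+1)^`() = (2 * n%:R + 3) *: b ^+ n.+1 + (2 * n%:R + 2) *: b ^+ n.
    rewrite derivM derivX deriv_exp /= derivB derivXn -polyC1 derivC subr0 /= expr1.
    by rewrite -[_ *+ n.+1]mulr_natl -!mul_polyC !polyCD !polyCM !polyC_natr /b (exprS _ n); ring.
  by rewrite poly_integralD !poly_integralZ => h; lra.
have n0 : 0 <= n%:R :> R by exact: ler0n.
have f3 : 2 * n%:R + 3 != 0 :> R by rewrite gt_eqF //; lra.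
have -> : poly_integral (b ^+ n.+1) = - (2 * n%:R + 2) / (2 * n%:R + 3) * poly_integral (b ^+ n).
  by rewrite mulrAC -rec mulrAC mulfV // mul1r.
have -> : (2 * n.+1)`!%:R = (2 * n%:R + 2) * (2 * n%:R + 1) * ((2 * n)`!)%:R :> R.
  rewrite mulnS !factS !natrM -!natr1 natrM; ring.
rewrite factS natrM -natr1.
have f1 : 2 * n%:R + 1 != 0 :> R by rewrite gt_eqF //; lra.
transitivity ((2 * n%:R + 2) ^+ 2 * (2 * n%:R + 1) / (2 * n%:R + 3) *
   ((-1) ^+ n * ((2 * n)`!)%:R * poly_integral (b ^+ n))).
  by rewrite (exprS (-1)); field.
rewrite IH (exprS 2); field.
by rewrite f1 andbT gt_eqF //; lra.
Qed.

Lemma derivn_derivn (p : {poly R}) (k n : nat) : (p^`(k))^`(n) = p^`(n + k).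
Proof. by rewrite /derivn iterD. Qed.

(** After [n] integrations by parts, [n + k] derivatives fall on a polynomial of degree
    [2 * k < n + k]. *)
Lemma poly_integral_legendreP_lt (k n : nat) : (k < n)%N ->
  poly_integral (legendreP n * legendreP k) = 0.
Proof.
move=> kn; rewrite /legendreP -scalerAl poly_integralZ.
rewrite poly_integral_derivn_rodrigues // linearZ /= derivn_derivn.
rewrite [derivn _ _](_ : _ = 0) ?scaler0 ?mulr0; last first.
  apply: derivn_poly0; rewrite size_rodrigues.
  by rewrite mul2n -addnn -addSn leq_add2r.
by rewrite -(scale0r 0) poly_integralZ mul0r !mulr0.
Qed.

Lemma poly_integral_legendreP_sqr (n : nat) :
  poly_integral (legendreP n * legendreP n) = 2 / (2 * n%:R + 1).
Proof.
rewrite /legendreP -scalerAl poly_integralZ.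
rewrite poly_integral_derivn_rodrigues // linearZ /= derivn_derivn addnn -mul2n.
rewrite derivn_rodrigues_top -scalerAr poly_integralZ [_ * (2 * n)`!%:R]mulr_natr.
rewrite -scaler_nat poly_integralZ.
set u := _^-1; rewrite [LHS](_ : _ = u ^+ 2 * ((-1) ^+ n * (2 * n)`!%:R *
  poly_integral (('X ^+ 2 - 1) ^+ n))); last by ring.
by rewrite poly_integral_rodrigues mulrCA -exprMn /u mulVf ?expr1n ?mulr1 //.
Qed.

Lemma poly_integral_legendreP (k n : nat) :
  poly_integral (legendreP k * legendreP n) = (k == n)%:R * (2 / (2 * n%:R + 1)).
Proof.
case: (ltngtP k n) => [kn|nk|->]; last by rewrite poly_integral_legendreP_sqr mul1r.
  by rewrite mulrC poly_integral_legendreP_lt ?mul0r.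
by rewrite poly_integral_legendreP_lt ?mul0r.
Qed.

Definition legendre_poly (n : nat) : {poly R} := Num.sqrt (2 * n%:R + 1) *: legendreP n.

Lemma horner_legendre_poly (n : nat) (x : R) : (legendre_poly n).[x] = legendreL n x.
Proof. by rewrite hornerZ. Qed.

Lemma poly_integral_legendre_sum (N : nat) (v : 'I_N -> R) :
  poly_integral ((\sum_(k < N) v k *: legendre_poly k) ^+ 2) = 2 * \sum_(k < N) v k ^+ 2.
Proof.
rewrite expr2 mulr_suml poly_integral_sum mulr_sumr; apply: eq_bigr => k _.
rewrite mulr_sumr poly_integral_sum (bigD1 k) //= big1 => [|l lk].
  rewrite addr0 -scalerAl -scalerAr -scalerAl -scalerAr !poly_integralZ.
  rewrite poly_integral_legendreP eqxx.
  have k0 : 0 <= k%:R :> R by exact: ler0n.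
  have k1 : 0 < 2 * k%:R + 1 :> R by lra.
  have := sqr_sqrtr (ltW k1); set q := Num.sqrt _ => hq.
  rewrite -hq mul1r; field.
  by apply/eqP => q0; move: hq; rewrite q0 expr0n /= => hq; lra.
rewrite -scalerAl -scalerAr -scalerAl -scalerAr !poly_integralZ.
by rewrite poly_integral_legendreP (_ : (k == l :> nat) = false) ?mul0r ?mulr0 // eq_sym; exact: negbTE.
Qed.

(** * Legendre's differential equation and values at the origin *)

Lemma legendreP_ode (n : nat) :
  (1 - 'X ^+ 2) * (legendreP n)^`()^`() =
  2 * 'X * (legendreP n)^`() - n%:R * (n%:R + 1) * legendreP n.
Proof.
(* The equation is the case [k = n] of the recurrence. *)
have := derivn_rodrigues_rec n n; set W := ('X ^+ 2 - 1) ^+ n => h.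
rewrite /legendreP -/W derivZ derivZ -!derivnS; set a := _^-1.
rewrite -!mul_polyC.
transitivity (- a%:P * (('X ^+ 2 - 1) * W^`(n.+2))); first by ring.
by rewrite h; ring.
Qed.

(* |P_(2k) (0)| *)
Definition central_ratio (k : nat) : R := \prod_(i < k) ((2 * i%:R + 1) / (2 * i%:R + 2)).

(** The left side is nonincreasing in [k] because [(2 k + 1) (2 k + 3) <= (2 k + 2) ^ 2]. *)
Lemma central_ratio_sqr_le (k : nat) : central_ratio k ^+ 2 * (2 * k%:R + 1) <= 1.
Proof.
elim: k => [|k IH]; first by rewrite /central_ratio big_ord0 mulr0 add0r expr1n mulr1.
rewrite /central_ratio big_ord_recr /= -/(central_ratio k) -natr1.
set c := central_ratio k in IH *; have k0 : 0 <= k%:R :> R by exact: ler0n.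
set y : R := k%:R in IH k0 *.
rewrite (_ : _ * _ = (c ^+ 2 * (2 * y + 1)) * ((2 * y + 1) * (2 * y + 3) / (2 * y + 2) ^+ 2)); last first.
  by field; rewrite gt_eqF //; lra.
rewrite -[leRHS]mul1r; apply: ler_pM => //.
- by rewrite mulr_ge0 ?sqr_ge0 //; lra.
- by rewrite divr_ge0 ?sqr_ge0 // mulr_ge0 //; lra.
by rewrite ler_pdivrMr ?mul1r ?exprn_gt0 //; nra.
Qed.

Lemma derivn_rodrigues_rec_at0 (n k : nat) :
  ((('X ^+ 2 - 1 : {poly R}) ^+ n)^`(k.+2)).[0] =
    - ((k%:R + 1) * (2 * n%:R - k%:R)) * ((('X ^+ 2 - 1 : {poly R}) ^+ n)^`(k)).[0].
Proof.
have nat0 j : (j%:R : {poly R}).[0] = j%:R by rewrite -polyC_natr hornerC.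
have := congr1 (fun p : {poly R} => p.[0]) (derivn_rodrigues_rec n k).
set u := _^`(k); set v := _^`(k.+1); set w := _^`(k.+2).
rewrite /= !(hornerD, hornerN, hornerM, hornerX, hornerXn, nat0, nat0 1) => {nat0}.
by move: u.[0] v.[0] w.[0] => a b c h; lra.
Qed.

(** Squaring absorbs the alternating signs of the recurrence and the initial value [(-1) ^ n]. *)
Lemma derivn_rodrigues_even_at0 (n j : nat) :
  ((('X ^+ 2 - 1 : {poly R}) ^+ n)^`(2 * j)).[0] ^+ 2 =
    (\prod_(i < j) ((2 * i%:R + 1) * (2 * n%:R - 2 * i%:R))) ^+ 2.
Proof.
elim: j => [|j IH].
  rewrite big_ord0 muln0 derivn0 horner_exp !hornerE expr0n /= sub0r.
  by rewrite -exprM mulnC exprM sqrrN !expr1n.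
rewrite mulnS !addSn add0n derivn_rodrigues_rec_at0 exprMn IH big_ord_recr /= natrM; ring.
Qed.

Lemma derivn_rodrigues_odd_at0 (n j : nat) :
  ((('X ^+ 2 - 1 : {poly R}) ^+ n)^`((2 * j).+1)).[0] = 0.
Proof.
elim: j => [|j IH].
  rewrite muln0 derivn1 deriv_exp derivB derivXn derivC subr0 /= expr1.
  by rewrite hornerMn hornerM hornerMn hornerX mul0rn mul0r mul0rn.
by rewrite mulnS !addSn add0n derivn_rodrigues_rec_at0 IH mulr0.
Qed.

(** The factors [2 i + 1] multiply to [central_ratio k * 2 ^ k * k!], the factors [2 n - 2 i] to
    [2 ^ k * n! / (n - k)!]. *)
Lemma prod_central_ratio (n k : nat) : (k <= n)%N ->
  (\prod_(i < k) ((2 * i%:R + 1) * (2 * n%:R - 2 * i%:R)) : R) * (n - k)`!%:R =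
  central_ratio k * (2 ^+ k * k`!%:R) * 2 ^+ k * n`!%:R.
Proof.
elim: k => [|k IH] kn.
  by rewrite /central_ratio !big_ord0 subn0 fact0; ring.
rewrite /central_ratio !big_ord_recr /= -/(central_ratio k).
have {IH} := IH (ltnW kn); rewrite -(subnSK kn) factS natrM subnSK // natrB ?(ltnW kn) //.
set p := \prod_(i < k) _ => h.
have k0 : 0 <= k%:R :> R by exact: ler0n.
transitivity (2 * (2 * k%:R + 1) * (p * ((n%:R - k%:R) * (n - k.+1)`!%:R))); first by ring.
rewrite h !(exprS 2) factS natrM -natr1; field.
by rewrite gt_eqF //; lra.
Qed.

Lemma legendreP_even_at0 (k : nat) :
  (legendreP (2 * k)).[0] ^+ 2 = central_ratio k ^+ 2 /\ (legendreP (2 * k))^`().[0] = 0.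
Proof.
rewrite /legendreP derivZ -derivnS !hornerZ derivn_rodrigues_odd_at0 mulr0; split=> //.
rewrite exprMn derivn_rodrigues_even_at0 -exprMn; congr (_ ^+ 2).
have := @prod_central_ratio (2 * k) k; rewrite {1}mul2n -addnn leq_addr => /(_ isT).
rewrite [(2 * k - k)%N](_ : _ = k); last by rewrite mul2n -addnn addnK.
set p := \prod_(i < k) _ => h.
have f0 (j : nat) : j`!%:R != 0 :> R by rewrite pnatr_eq0 -lt0n fact_gt0.
apply: (mulIf (f0 k)); rewrite -mulrA h.
have -> : 2 ^+ (2 * k) = 2 ^+ k * 2 ^+ k :> R by rewrite mul2n -addnn exprD.
have e0 : 2 ^+ k != 0 :> R by rewrite expf_neq0 ?pnatr_eq0.
by field; rewrite e0 f0.
Qed.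

Lemma legendreP_odd_at0 (k : nat) :
  (legendreP (2 * k).+1).[0] = 0 /\
  (legendreP (2 * k).+1)^`().[0] ^+ 2 = ((2 * k%:R + 1) * central_ratio k) ^+ 2.
Proof.
rewrite /legendreP derivZ -derivnS !hornerZ derivn_rodrigues_odd_at0 mulr0; split=> //.
rewrite -[(2 * k).+2]/(2 + 2 * k)%N -mulnS exprMn derivn_rodrigues_even_at0 -exprMn.
congr (_ ^+ 2).
have := @prod_central_ratio (2 * k).+1 k.+1; rewrite ltnS {1}mul2n -addnn leq_addr => /(_ isT).
rewrite [((2 * k).+1 - k.+1)%N](_ : _ = k); last by rewrite subSS mul2n -addnn addnK.
set p := \prod_(i < k.+1) _ => h.
have f0 (j : nat) : j`!%:R != 0 :> R by rewrite pnatr_eq0 -lt0n fact_gt0.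
have k0 : 0 <= k%:R :> R by exact: ler0n.
have e0 : 2 ^+ k != 0 :> R by rewrite expf_neq0 ?pnatr_eq0.
have k2 : 2 * k%:R + 2 != 0 :> R by rewrite gt_eqF //; lra.
apply: (mulIf (f0 k)); rewrite -mulrA h.
rewrite /central_ratio big_ord_recr /= -/(central_ratio k).
have -> : 2 ^+ (2 * k).+1 = 2 * 2 ^+ k * 2 ^+ k :> R by rewrite exprS mul2n -addnn exprD mulrA.
rewrite (exprS 2) (factS k) natrM -(natr1 k).
by field; rewrite e0 f0 k2.
Qed.

(* The value at the origin of the Sonin function of [sqrt (sin t) * P_n (cos t)]. *)
Lemma legendreP_energy_at0 (n : nat) :
  (2 * n%:R + 1) * ((legendreP n).[0] ^+ 2 +
    4 * (legendreP n)^`().[0] ^+ 2 / ((2 * n%:R + 1) ^+ 2 + 1)) <= 2.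
Proof.
have := odd_double_half n; set k := n./2; rewrite -mul2n.
have c1 := central_ratio_sqr_le k; have k0 : 0 <= k%:R :> R by exact: ler0n.
have c0 := sqr_ge0 (central_ratio k).
(* By parity either the value or the derivative at 0 vanishes; both cases then follow from
   [central_ratio k ^ 2 * (2 k + 1) <= 1]. *)
case: (odd n) => /= <-.
  rewrite add1n; have [-> ->] := legendreP_odd_at0 k.
  rewrite expr0n add0r -(natr1 (2 * k)) natrM.
  set y : R := k%:R in c1 k0 *; set c := central_ratio k in c1 c0 *.
  rewrite mulrA ler_pdivrMr; last by rewrite ltr_wpDl ?sqr_ge0.
  rewrite exprMn.
  have : (2 * (2 * y + 1) + 1) * 4 * (2 * y + 1) * (c ^+ 2 * (2 * y + 1)) <=
     (2 * (2 * y + 1) + 1) * 4 * (2 * y + 1) * 1.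
    by apply: ler_wpM2l => //; rewrite !mulr_ge0 //; lra.
  by nra.
rewrite add0n; have [-> ->] := legendreP_even_at0 k.
rewrite expr0n mulr0 mul0r addr0 natrM.
by move: c1 c0; set c := _ ^+ 2; nra.
Qed.

(** * Uniform bound on preconditioned Legendre polynomials *)

(** The sign condition says that the derivative of the quotient is nonnegative left of 0 and
    nonpositive right of 0; the mean value theorem concludes on each side. *)
Lemma poly_ratio_le_at0 (K : realType) (A E : {poly K}) (x : K) : -1 < x < 1 ->
  (forall y, -1 < y < 1 -> 0 < E.[y]) ->
  (forall y, -1 < y < 1 -> y * (A^`().[y] * E.[y] - A.[y] * E^`().[y]) <= 0) ->
  A.[x] / E.[x] <= A.[0] / E.[0].
Proof.
move=> /andP[x1 x2] Epos sgn.
pose f (y : K) := A.[y] / E.[y].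
pose df (y : K) := (A^`().[y] * E.[y] - A.[y] * E^`().[y]) / E.[y] ^+ 2.
have fE (y : K) : -1 < y < 1 -> is_derive y 1 f (df y).
  move=> hy; have En : E.[y] != 0 by rewrite gt_eqF // Epos.
  have h := is_deriveM (is_derive_poly A y) (is_deriveV En (is_derive_poly E y)).
  apply: (is_derive_eq h); rewrite /df /GRing.scale /=; field.
  by rewrite En.
have df_sgn (y : K) : -1 < y < 1 -> y * df y <= 0.
  move=> hy; rewrite /df mulrA; have := sgn y hy => h.
  by rewrite pmulr_lle0 // invr_gt0 exprn_gt0 // Epos.
have fc (a b : K) : -1 < a -> b < 1 -> {within `[a, b], continuous f}.
  move=> ha hb; apply: derivable_within_continuous => y; rewrite in_itv /= => /andP[ay yb].
  by have [] : is_derive y 1 f (df y) by apply: fE; rewrite (lt_le_trans ha ay) (le_lt_trans yb hb).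
rewrite -[leLHS]/(f x) -[leRHS]/(f 0).
have [x0|x0|->] := ltgtP x 0; last by [].
- have hd y : y \in `]x, 0[ -> is_derive y 1 f (df y).
    by rewrite in_itv /= => /andP[h1 h2]; apply: fE; rewrite (lt_trans x1 h1) (lt_trans h2).
  have [|y] := MVT x0 hd; first exact: fc.
  rewrite in_itv /= => /andP[h1 h2] hf.
  have : y * df y <= 0 by apply: df_sgn; rewrite (lt_trans x1 h1) (lt_trans h2).
  rewrite nmulr_rle0 // -[f x <= _]subr_ge0 hf sub0r => h.
  by rewrite mulr_ge0 // oppr_ge0 ltW.
have hd y : y \in `]0, x[ -> is_derive y 1 f (df y).
  by rewrite in_itv /= => /andP[h1 h2]; apply: fE; rewrite (lt_trans _ h1) ?(lt_trans h2) // ltrN10.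
have [|y] := MVT x0 hd; first by apply: fc; rewrite ?ltrN10.
rewrite in_itv /= => /andP[h1 h2] hf.
have : y * df y <= 0 by apply: df_sgn; rewrite (lt_trans _ h1) ?(lt_trans h2) // ltrN10.
rewrite pmulr_rle0 // -[f x <= _]subr_le0 hf subr0 => h.
by rewrite pmulr_lle0.
Qed.

(* [u t = sqrt (sin t) * P (cos t)] solves [u'' + q * u = 0] with
   [q t = (nu + 1/2) ^ 2 + 1 / (4 * sin t ^ 2)] decreasing on ]0, pi/2[, so that the
   Sonin function [u ^ 2 + u' ^ 2 / q] is maximal at [pi/2], i.e. at [x = cos t = 0].
   Below, [U / D] is this function divided by [sin t]. *)
Lemma legendre_ode_envelope (P : {poly R}) (nu x : R) : -1 < x < 1 ->
  (forall y, (1 - y * y) * P^`()^`().[y] = 2 * y * P^`().[y] - nu * (nu + 1) * P.[y]) ->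
  (1 - x ^+ 2) * (P.[x] ^+ 2) ^+ 2 <=
  (P.[0] ^+ 2 + 4 * P^`().[0] ^+ 2 / ((2 * nu + 1) ^+ 2 + 1)) ^+ 2.
Proof.
move=> x1 ode.
pose a : R := (2 * nu + 1) ^+ 2.
have a0 : 0 <= a by exact: sqr_ge0.
(* With [1 - x ^ 2 = sin t ^ 2], one has [D = 4 q sin t ^ 2] and [M ^ 2 = u' ^ 2 sin t]. The
   quotient [A / E] is the square of the Sonin function; squaring makes it rational in [x]. *)
pose D : {poly R} := a%:P * (1 - 'X * 'X) + 1.
pose M : {poly R} := (1 - 'X * 'X) * P^`() - (2^-1)%:P * ('X * P).
pose U : {poly R} := P * P * D + 4%:P * (M * M).
pose A : {poly R} := (1 - 'X * 'X) * (U * U).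
pose E : {poly R} := D * D.
have Dx (y : R) : D.[y] = a * (1 - y * y) + 1.
  by rewrite /D !(hornerE, hornerD, hornerN, hornerM).
have Mx (y : R) : M.[y] = (1 - y * y) * P^`().[y] - 2^-1 * (y * P.[y]).
  by rewrite /M !(hornerE, hornerD, hornerN, hornerM).
have Ux (y : R) : U.[y] = P.[y] * P.[y] * D.[y] + 4 * (M.[y] * M.[y]).
  by rewrite /U !(hornerD, hornerM, hornerC).
have Ax (y : R) : A.[y] = (1 - y * y) * (U.[y] * U.[y]).
  by rewrite /A !(hornerE, hornerD, hornerN, hornerM).
have Ex (y : R) : E.[y] = D.[y] * D.[y] by rewrite /E hornerM.
have Dpos (y : R) : -1 < y < 1 -> 0 < D.[y].
  move=> /andP[h1 h2]; rewrite Dx ltr_wpDl // mulr_ge0 //; nra.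
have Epos (y : R) : -1 < y < 1 -> 0 < E.[y].
  by move=> /Dpos h; rewrite Ex mulr_gt0.
have sq0 (z : R) : 0 <= z * z by rewrite -expr2 sqr_ge0.
have U0 (y : R) : -1 < y < 1 -> 0 <= U.[y].
  move=> /Dpos h; rewrite Ux addr_ge0 //; last by rewrite mulr_ge0 // sq0.
  by rewrite mulr_ge0 ?sq0 // ltW.
have wronskian (y : R) : A^`().[y] * E.[y] - A.[y] * E^`().[y] =
    - 16 * y * (U.[y] * (M.[y] * M.[y]) * D.[y]).
  have d1 : (1 : {poly R})^`() = 0 by rewrite -polyC1 derivC.
  have one : (1 : {poly R}).[y] = 1 by rewrite -polyC1 hornerC.
  have dD : D^`().[y] = - (2 * a * y).
    rewrite /D !(derivD, derivN, derivM, derivC, derivX, d1).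
    by rewrite !(hornerD, hornerN, hornerM, hornerC, hornerX, horner0, one); ring.
  have dM : M^`().[y] = (1 - y * y) * P^`()^`().[y] - 2 * y * P^`().[y]
      - 2^-1 * (P.[y] + y * P^`().[y]).
    rewrite /M !(derivD, derivN, derivM, derivC, derivX, d1).
    by rewrite !(hornerD, hornerN, hornerM, hornerC, hornerX, horner0, one); ring.
  have dsq (p : {poly R}) : (p * p)^`().[y] = 2 * p.[y] * p^`().[y].
    by rewrite derivM hornerD !hornerM; ring.
  have dmul (p r : {poly R}) : (p * r)^`().[y] = p^`().[y] * r.[y] + p.[y] * r^`().[y].
    by rewrite derivM hornerD !hornerM.
  have dU : U^`().[y] = 2 * P.[y] * P^`().[y] * D.[y] + P.[y] * P.[y] * D^`().[y]
      + 8 * M.[y] * M^`().[y].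
    by rewrite derivD hornerD !dmul derivC horner0 hornerC !hornerM; ring.
  have dA : A^`().[y] = - (2 * y) * (U.[y] * U.[y]) + (1 - y * y) * (2 * U.[y] * U^`().[y]).
    rewrite dmul dsq derivB d1 derivM derivX hornerM.
    by rewrite !(hornerD, hornerN, hornerX, horner0, one) !hornerM hornerX one; ring.
  have dE : E^`().[y] = 2 * D.[y] * D^`().[y] by exact: dsq.
  rewrite dA dE Ex Ax dU dM ode dD Ux Mx Dx /a.
  by move: P.[y] P^`().[y] => p p1; field.
have : A.[x] / E.[x] <= A.[0] / E.[0].
  apply: poly_ratio_le_at0 => // y hy; rewrite wronskian.
  rewrite (_ : y * _ = - (16 * ((y * y) * (U.[y] * (M.[y] * M.[y]) * D.[y])))); last by ring.
  by rewrite oppr_le0 mulr_ge0 // mulr_ge0 // mulr_ge0 ?(ltW (Dpos y hy)) // mulr_ge0 // U0.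
have -> : A.[0] / E.[0] = (P.[0] ^+ 2 + 4 * P^`().[0] ^+ 2 / (a + 1)) ^+ 2.
  have a1 : a + 1 != 0 by rewrite gt_eqF //; lra.
  have D0 : D.[0] = a + 1 by rewrite Dx mulr0 subr0 mulr1.
  by rewrite Ax Ex Ux Mx D0; field; rewrite a1.
apply: le_trans.
(* Dropping the nonnegative term [4 M ^ 2] from [U] leaves [P ^ 2 <= U / D]. *)
have Dx0 := Dpos x x1.
rewrite Ax Ex -mulrA ler_wpM2l //; first by case/andP: x1 => h1 h2; nra.
rewrite ler_pdivlMr ?mulr_gt0 // -expr2 -expr2 -exprMn lerXn2r ?nnegrE ?U0 //.
  by rewrite mulr_ge0 ?sqr_ge0 ?ltW.
by rewrite Ux expr2 lerDl mulr_ge0 // -expr2 sqr_ge0.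
Qed.

(** The envelope and the energy at the origin give [sqrt (1 - x ^ 2) (2 n + 1) P_n ^ 2 <= 2]; the
    square in question is [pi / 2 < 2] times this quantity. *)
Lemma precond_legendreL_le2 (n : nat) (x : R) : `|precond x * legendreL n x| <= 2.
Proof.
(* Outside the open interval [1 - x ^ 2 <= 0], where [Num.sqrt] is 0. *)
have [x1|x1] := boolP (-1 < x < 1); last first.
  rewrite /precond (@ler0_sqrtr _ (1 - x ^+ 2)) ?sqrtr0 ?mulr0 ?mul0r ?normr0 //.
  rewrite subr_le0; move: x1; rewrite negb_and -!leNgt => /orP[]; nra.
have n0 : 0 <= n%:R :> R by exact: ler0n.
have n1 : 0 <= 2 * n%:R + 1 :> R by lra.
have env := @legendre_ode_envelope (legendreP n) n%:R x x1.
set h := _ + _ / _ in env.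
have h0 : 0 <= h.
  apply: addr_ge0; first exact: sqr_ge0.
  by apply: divr_ge0; [rewrite mulr_ge0 ?sqr_ge0 | rewrite addr_ge0 ?sqr_ge0].
have y0 : 0 <= 1 - x ^+ 2 by case/andP: x1 => h1 h2; nra.
set w := Num.sqrt (1 - x ^+ 2).
have w0 : 0 <= w by exact: sqrtr_ge0.
have wP : w * (legendreP n).[x] ^+ 2 <= h.
  have wP0 := mulr_ge0 w0 (sqr_ge0 (legendreP n).[x]).
  rewrite -(@ler_pXn2r _ 2) ?nnegrE //.
  rewrite exprMn sqr_sqrtr //; apply: env => y.
  have := congr1 (fun q : {poly R} => q.[y]) (legendreP_ode n).
  have nat0 j : (j%:R : {poly R}).[y] = j%:R by rewrite -polyC_natr hornerC.
  rewrite /= !(hornerD, hornerN, hornerM, hornerX, hornerXn, nat0, nat0 1) => {nat0}.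
  by rewrite !mulr1n => ->; ring.
have bound : w * (2 * n%:R + 1) * (legendreP n).[x] ^+ 2 <= 2.
  apply: le_trans (legendreP_energy_at0 n); rewrite -/h mulrAC mulrC.
  by apply: ler_wpM2l.
have pi4 := pihalf_lt2 R.
rewrite -(@ler_pXn2r _ 2) ?nnegrE // real_normK ?num_real //.
have pi0 : 0 <= pi / 2 :> R by rewrite divr_ge0 // pi_ge0.
rewrite /precond /legendreL !exprMn !sqr_sqrtr ?sqrtr_ge0 // -/w.
set P2 := _.[x] ^+ 2 in bound *.
have -> : pi / 2 * w * ((2 * n%:R + 1) * P2) = pi / 2 * (w * (2 * n%:R + 1) * P2) by ring.
rewrite expr2; apply: ler_pM => //; last exact: ltW.
by rewrite mulr_ge0 ?sqr_ge0 // mulr_ge0.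
Qed.

(** * Integration against the Chebyshev measure *)

Import HBNNSimple.

(** Monotone convergence along simple functions reduces the claim to indicators, where it is the
    hypothesis on [nu]. *)
Lemma ge0_integral_density (d : measure_display) (T : measurableType d) (K : realType)
    (mu nu : {measure set T -> \bar K}) (D : set T) (w : T -> K) (f : T -> \bar K) :
  measurable D -> measurable_fun D w -> (forall x, 0 <= w x) ->
  (forall A, measurable A -> nu A = \int[mu]_(x in A `&` D) (w x)%:E)%E ->
  measurable_fun setT f -> (forall x, 0 <= f x)%E ->
  (\int[mu]_(x in D) (f x * (w x)%:E) = \int[nu]_x f x)%E.
Proof.
move=> mD mw w0 nuE mf f0.
have mwE : measurable_fun D (EFin \o w) by apply/measurable_EFinP.
pose h := nnsfun_approx measurableT mf.
have mh n A : measurable_fun A (EFin \o h n) by apply/measurable_EFinP; exact: measurable_funTS.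
have hnd x : {homo (fun n => (h n x)%:E) : n m / (n <= m)%N >-> (n <= m)%E}.
  by move=> n m nm; rewrite lee_fin; exact/lefP/nd_nnsfun_approx.
have hf x : (h n x)%:E @[n --> \oo] --> f x by exact: cvg_nnsfun_approx.
have -> : (\int[nu]_x f x = limn (fun n => \int[nu]_x (h n x)%:E))%E.
  rewrite -monotone_convergence //; first last.
  - by move=> n x _; rewrite lee_fin.
  - by move=> n; exact: mh.
  by apply: eq_integral => x _; apply/esym/cvg_lim => //; exact: hf.
have -> : (\int[mu]_(x in D) (f x * (w x)%:E) =
    limn (fun n => \int[mu]_(x in D) ((h n x)%:E * (w x)%:E)))%E.
  rewrite -monotone_convergence //; first last.
  - by move=> x _ n m nm; rewrite lee_wpmul2r ?lee_fin // -?lee_fin; exact: hnd.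
  - by move=> n x _; rewrite mule_ge0 ?lee_fin.
  - by move=> n; apply: emeasurable_funM => //; exact: mh.
  apply: eq_integral => x _; apply/esym/cvg_lim => //.
  by apply: cvgeZr => //; exact: hf.
congr (limn _); apply/funext => n.
rewrite integralT_nnsfun sintegralE.
have mi y : measurable_fun D (fun x => (y * \1_(h n @^-1` [set y]) x)%:E).
  by apply/measurable_EFinP; apply: measurable_funM => //; exact: measurable_funTS.
have pos x y : (0 <= (y * \1_(h n @^-1` [set y]) x)%:E)%E by exact: nnfun_muleindic_ge0.
transitivity (\int[mu]_(x in D) \sum_(y \in range (h n))
    ((y * \1_(h n @^-1` [set y]) x)%:E * (w x)%:E))%E.
  apply: eq_integral => x _; rewrite -ge0_mule_fsuml; last by move=> y; exact: pos.
  by rewrite fsumEFin // -fimfunE.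
rewrite ge0_integral_fsum //; last 2 first.
- by move=> y; apply: emeasurable_funM.
- by move=> y x _; rewrite mule_ge0 ?lee_fin // -?lee_fin.
apply: eq_fsbigr => y; rewrite inE => -[x0 _ yE].
under eq_integral do rewrite EFinM -muleA.
rewrite ge0_integralZl //; first last.
- by rewrite -yE lee_fin.
- by move=> x _; rewrite mule_ge0 ?lee_fin.
- apply: emeasurable_funM => //; apply/measurable_EFinP; exact: measurable_funTS.
congr (_ * _)%E; rewrite nuE // setIC integral_mkcondr.
apply: eq_integral => x _; rewrite epatch_indic muleC //.
Qed.

Lemma integral_deriv_poly (K : realType) (q : {poly K}) :
  (\int[@lebesgue_measure K]_(x in `](-1)%R, 1%R[) (q^`().[x])%:E = (q.[1] - q.[-1])%:E)%E.
Proof.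
have mq (A : set (measurableTypeR K)) :
    measurable_fun A (fun x => (q^`().[x])%:E : \bar K).
  apply/measurable_EFinP/measurable_funTS; apply: continuous_measurable_fun.
  exact: continuous_horner.
have q_lr : derivable_oo_LRcontinuous (horner q) (-1) 1.
  split=> [x _|  |]; first exact: derivable_horner.
  - by apply: cvg_at_right_filter; exact: continuous_horner.
  - by apply: cvg_at_left_filter; exact: continuous_horner.
have lt11 : -1 < 1 :> K by rewrite (lt_trans _ ltr01) // ltrN10.
have cq' : {within `[-1, 1], continuous (horner q^`())}.
  by apply: continuous_subspaceT; exact: continuous_horner.
have dq : {in `]-1, 1[, (horner q)^`()%classic =1 horner q^`()}.
  by move=> x _; rewrite -derivE.
rewrite EFinB -(continuous_FTC2 lt11 cq' q_lr dq).
rewrite -(@integral_itv_bndoo K (-1) 1 _ true false) //; exact: mq.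
Qed.

Lemma continuous_sqrt_sqrt_one_sub_sqr (K : realType) (a : K) :
  continuous (fun y : K => Num.sqrt a * Num.sqrt (Num.sqrt (1 - y ^+ 2))).
Proof.
move=> y; apply: cvgM; first exact: cvg_cst.
apply: (cvg_comp (fun y : K => Num.sqrt (1 - y ^+ 2)) Num.sqrt); last exact: sqrt_continuous.
apply: (cvg_comp (fun y : K => 1 - y ^+ 2) Num.sqrt); last exact: sqrt_continuous.
by apply: cvgB; [exact: cvg_cst | exact: exprn_continuous].
Qed.

Lemma measurable_precond_legendreL (n : nat) :
  measurable_fun setT ((fun y => precond y * legendreL n y) : Rm -> Rm).
Proof.
apply: (@measurable_funM _ Rm _ setT (fun y => precond y) (fun y => legendreL n y)).
  by apply: continuous_measurable_fun; exact: continuous_sqrt_sqrt_one_sub_sqr.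
apply: measurable_funM => //; apply: continuous_measurable_fun.
exact: continuous_horner.
Qed.

Lemma measurable_cheb_density : @measurable_fun _ _ Rm Rm (`](-1)%R, 1%R[ : set R) cheb_density.
Proof.
apply: open_continuous_measurable_fun; first exact: interval_open.
move=> y; rewrite inE /= in_itv /= => /andP[y1 y2].
have y0 : 0 < 1 - y ^+ 2 by nra.
apply: cvgV; first by rewrite mulf_neq0 ?gt_eqF ?sqrtr_gt0 ?pi_gt0.
apply: cvgM; first exact: cvg_cst.
apply: (cvg_comp (fun y => 1 - y ^+ 2) Num.sqrt); last exact: sqrt_continuous.
by apply: cvgB; [exact: cvg_cst | exact: exprn_continuous].
Qed.

Lemma precond_sqr_cheb_density (x : R) : -1 < x < 1 ->
  precond x ^+ 2 * cheb_density x = 1 / 2.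
Proof.
move=> /andP[h1 h2]; rewrite /precond /cheb_density exprMn !sqr_sqrtr ?sqrtr_ge0 //.
  have pi0 := @pi_gt0 R.
  have w0 : 0 < Num.sqrt (1 - x ^+ 2) by rewrite sqrtr_gt0; nra.
  move: (pi : R) pi0 => p p0.
  by field; rewrite (gt_eqF w0) (gt_eqF p0).
by rewrite divr_ge0 // pi_ge0.
Qed.

(** On the open interval [precond ^ 2] times the Chebyshev density is 1/2, so the integral is that
    of [F ^ 2 / 2] for Lebesgue measure, where the Legendre polynomials are orthonormal. *)
Lemma legendre_energy (mu : probability Rm R) (N : nat) (v : 'I_N -> R) :
  (forall A : set Rm, measurable A -> mu A = chebyshev_measure A) ->
  (\int[mu]_y ((\sum_(k < N) v k * (precond y * legendreL k y)) ^+ 2)%:E =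
   (\sum_(k < N) v k ^+ 2)%:E)%E.
Proof.
move=> muE.
pose F := \sum_(k < N) v k *: legendre_poly k.
have Fx y : \sum_(k < N) v k * (precond y * legendreL k y) = precond y * F.[y].
  rewrite horner_sum mulr_sumr; apply: eq_bigr => k _.
  by rewrite hornerZ horner_legendre_poly mulrCA.
rewrite -(@ge0_integral_density _ Rm _ lebesgue_measure mu (`](-1)%R, 1%R[ : set R) cheb_density) //.
- have int := @integral_deriv_poly R (poly_antideriv (2^-1 *: F ^+ 2)).
  rewrite deriv_poly_antideriv -/(poly_integral (2^-1 *: F ^+ 2)) in int.
  rewrite poly_integralZ poly_integral_legendre_sum mulKf ?pnatr_eq0 // in int.
  rewrite -int; apply: eq_integral => y; rewrite inE /= in_itv /= => hy.
  rewrite -EFinM Fx exprMn mulrAC precond_sqr_cheb_density // hornerZ horner_exp.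
  by rewrite div1r.
- exact: measurable_cheb_density.
- by move=> y; rewrite /cheb_density invr_ge0 mulr_ge0 ?pi_ge0 ?sqrtr_ge0.
- apply/measurable_EFinP; apply: (@measurable_funX _ Rm).
  by apply: measurable_convex_comb => k; exact: measurable_precond_legendreL.
- by move=> y; rewrite lee_fin sqr_ge0.
Qed.

(** * Parameters *)

(* The slack [1 - norm1 v / L] is spread evenly over all signed atoms, where it cancels. *)
Definition signed_weight (N : nat) (L : R) (v : 'I_N -> R) (kb : 'I_N * bool) : R :=
  (`|v kb.1| + (-1) ^+ kb.2 * v kb.1) / (2 * L) + (1 - norm1 v / L) / (2 * N%:R).

Lemma signed_weight_ge0 (N : nat) (L : R) (v : 'I_N -> R) (kb : 'I_N * bool) :
  0 < L -> norm1 v <= L -> 0 <= signed_weight L v kb.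
Proof.
move=> L0 vL; apply: addr_ge0; apply: divr_ge0; rewrite ?mulr_ge0 ?ler0n ?(ltW L0) //.
  case: kb => k [] /=; rewrite ?expr1 ?expr0 ?mulN1r ?mul1r.
    by rewrite subr_ge0 ler_norm.
  by rewrite -lerBlDr sub0r -normrN ler_norm.
by rewrite subr_ge0 ler_pdivrMr // mul1r.
Qed.

Lemma sum_signed (N : nat) (F : 'I_N * bool -> R) :
  \sum_kb F kb = \sum_(k < N) (F (k, true) + F (k, false)).
Proof.
rewrite (eq_bigr (fun kb => F (kb.1, kb.2))); last by case.
by rewrite -(pair_bigA _ (fun k b => F (k, b))); apply: eq_bigr => k _; rewrite big_bool.
Qed.

Lemma sum_signed_weight (N : nat) (L : R) (v : 'I_N -> R) : (0 < N)%N -> 0 < L ->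
  \sum_kb signed_weight L v kb = 1.
Proof.
move=> N0 L0; have N0' : N%:R != 0 :> R by rewrite pnatr_eq0 -lt0n.
have LN : L != 0 by rewrite gt_eqF.
rewrite sum_signed (eq_bigr (fun k => `|v k| / L + (1 - norm1 v / L) / N%:R)); last first.
  by move=> k _; rewrite /signed_weight /=; field; rewrite N0' LN.
rewrite big_split /= -mulr_suml -/(norm1 v) sumr_const card_ord -[X in _ + X]mulr_natr.
by rewrite divfK // addrC subrK.
Qed.

Lemma signed_weight_combE (N : nat) (L : R) (v a : 'I_N -> R) : 0 < L ->
  \sum_kb signed_weight L v kb * ((-1) ^+ kb.2 * L * a kb.1) = \sum_(k < N) v k * a k.
Proof.
move=> L0; rewrite sum_signed; apply: eq_bigr => k _; rewrite /signed_weight /= expr1 expr0.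
move: ((1 - _) / _) => e.
by field; rewrite gt_eqF.
Qed.

Lemma half_le_ln (K : realType) (n : nat) : (1 < n)%N -> 1 / 2 <= ln n%:R :> K.
Proof.
move=> n1; rewrite -[leLHS]expRK ler_ln ?posrE ?expR_gt0 // ?ltr0n ?(ltnW n1) //.
apply: (@le_trans _ _ 2); last by rewrite ler_nat.
by apply: le_trans (expR_le_quadratic (lexx _)) _; lra.
Qed.

(** With [y = m / Q], the hypothesis gives [y / t >= 2 rho ln M]. Half of this pays for the
    [M ^ (rho 4 ^ i)] averages and the other half leaves at least [t] in the exponent, so the sum is
    at most [t * expR (- t) <= 1] times [expR (- y)]. *)
Lemma union_bound_le (M t rho m : nat) (B : R) :
  (1 < M)%N -> (0 < t)%N -> (2 * t <= rho)%N -> 0 < B ->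
  2 * rho%:R * ln M%:R * t%:R * (40 * 40 * B ^+ 2) <= m%:R ->
  \sum_(i < t) (M ^ (rho * 4 ^ i))%:R * expR (- (m%:R * deviation B t i)) <=
  expR (- (m%:R / (40 * 40 * B ^+ 2))).
Proof.
move=> M1 t0 trho B0 hm; set Q := 40 * 40 * B ^+ 2 in hm *.
have Q0 : 0 < Q by rewrite mulr_gt0 ?exprn_gt0.
have t0' : 0 < t%:R :> R by rewrite ltr0n.
have M0' : 0 < M%:R :> R by rewrite ltr0n ltnW.
have lnM := half_le_ln R M1.
set y := m%:R / Q.
have yt : 2 * rho%:R * ln M%:R <= y / t%:R by rewrite ler_pdivlMr // ler_pdivlMr.
have trho' : 2 * t%:R <= rho%:R :> R by rewrite -natrM ler_nat.
apply: (@le_trans _ _ (\sum_(i < t) expR (- y) * expR (- t%:R))).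
  apply: ler_sum => i _.
  have -> : (M ^ (rho * 4 ^ i))%:R = expR ((rho%:R * 4 ^+ i) * ln M%:R) :> R.
    by rewrite -natrX -natrM expRM_natl lnK ?posrE // natrX.
  rewrite -!exp.expRD ler_expR.
  have -> : m%:R * deviation B t i = y + 4 ^+ i * (y / t%:R).
    by rewrite /deviation -/Q /y; field; rewrite (gt_eqF Q0) (gt_eqF t0').
  have i1 : 1 <= 4 ^+ i :> R by rewrite exprn_ege1 // ler1n.
  have h1 := ler_wpM2l (le_trans ler01 i1) yt.
  have rl : t%:R <= rho%:R * ln M%:R :> R 
    by apply: (@le_trans _ _ (rho%:R * (1 / 2))); [lra | rewrite ler_wpM2l ?ler0n].
  have h2 : rho%:R * ln M%:R <= 4 ^+ i * (rho%:R * ln M%:R) :> R.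
    by rewrite ler_peMl // (le_trans (ltW t0') rl).
  lra.
rewrite sumr_const card_ord -mulrnAr -[leRHS]mulr1; apply: ler_wpM2l; first exact: expR_ge0.
rewrite -[leLHS]mulr_natl expRN ler_pdivrMr ?expR_gt0 // mul1r.
by apply: le_trans (expR_ge1Dx _); rewrite lerDr.
Qed.

(** These are the requirements for [B ^ 2 = 64 s], [t = l + 6] and [rho = 128 (l + 20)]. As
    [s < 2 ^ (l + 1)], they come down to [32 * 64 * 2 <= 4 ^ 6] and
    [4 * 1600 * 64 * 2 <= 2 ^ 20]. *)
Lemma log_parameters (s : nat) (l := trunc_log 2 s) : (1 < s)%N ->
  [/\ (0 < l)%N, 32 * (64 * s%:R) <= 4 ^+ (l + 6) :> R,
    4 * expR (- ((128 * (l + 20))%N%:R / 128)) < (40 * 40 * (64 * s%:R))^-1 :> R,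
    l%:R <= 2 * ln s%:R :> R & 1 / 2 <= ln s%:R :> R].
Proof.
move=> s1; have s0 : (0 < s)%N by exact: ltnW.
have s0' : 0 < s%:R :> R by rewrite ltr0n.
have [sl ls] := (trunc_logP (isT : (1 < 2)%N) s0, trunc_log_ltn s (isT : (1 < 2)%N)).
rewrite -/l in sl ls.
have s2l : s%:R < 2 * 2 ^+ l :> R by rewrite -exprS -natrX ltr_nat.
have ln2 : 1 / 2 <= ln 2 :> R := half_le_ln R (isT : (1 < 2)%N).
have p2 : 0 < 2 ^+ l :> R by rewrite exprn_gt0.
split.
- by rewrite trunc_log_gt0.
- rewrite exprD expr4_sqr.
  have -> : (4 : R) ^+ 6 = 4 * 4 * (4 * 4) * (4 * 4) by ring.
  have : 1 <= 2 ^+ l :> R by rewrite exprn_ege1 // ler1n.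
  by nra.
- have e2 (n : nat) : 2 ^+ n <= expR n%:R :> R.
    rewrite -[n%:R]mulr1 expRM_natl lerXn2r ?nnegrE ?expR_ge0 //.
    by apply: le_trans (expR_ge1Dx 1).
  rewrite natrM mulrAC mulfV ?pnatr_eq0 // mul1r expRN.
  rewrite ltr_pdivrMr ?expR_gt0 // mulrC ltr_pdivlMr; last by rewrite mulr_gt0 // mulr_gt0.
  apply: lt_le_trans (e2 (l + 20)%N); rewrite exprD.
  have -> : (2 : R) ^+ 20 = (4 * 4 * 4 * 4 * 4) * (4 * 4 * 4 * 4 * 4) by ring.
  by lra.
- have : ln (2 ^+ l) <= ln s%:R :> R.
    by rewrite ler_ln ?posrE // -natrX ler_nat.
  rewrite lnXn // -[_ *+ l]mulr_natl.
  have : 0 <= l%:R :> R by exact: ler0n.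
  by nra.
exact: half_le_ln.
Qed.

Lemma natr_gt0_of_prod_le (C x y z : R) (m : nat) :
  0 < C -> 0 < x -> 0 < y -> 0 < z -> C * x * y * z <= m%:R -> (0 < m)%N.
Proof.
by move=> C0 x0 y0 z0 h; rewrite -(ltr_nat R); apply: lt_le_trans h; rewrite !mulr_gt0.
Qed.

(** * The restricted lower bound and the recovery theorem *)

Lemma restricted_lower_bound (d : measure_display) (T : measurableType d)
    (P : probability T R) (N m s : nat) (X : 'I_m -> T -> Rm) :
  (1 < N)%N -> (1 < s)%N ->
  40 * 40 * 64 * 4 * (7 * (128 * 21)) * 8 * s%:R * ln s%:R ^+ 3 * ln N%:R <= m%:R :> R ->
  (forall j, measurable_fun setT (X j)) ->
  (forall j (A : set Rm), measurable A -> P (X j @^-1` A) = chebyshev_measure A) ->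
  mutually_independent P X ->
  (0 < m)%N /\ exists G : set T, [/\ measurable G,
    ((1 - powR (N%:R : R) (- (1 * ln s%:R ^+ 3)))%:E <= P G)%E &
    forall t, G t -> forall v : 'I_N -> R, norm1 v <= 4 * Num.sqrt s%:R * norm2 v ->
      (1 / 20) ^+ 2 * m%:R * norm2 v ^+ 2 <=
      \sum_(j < m) (precond (X j t) * legendre_mat (fun j => X j t) v j) ^+ 2].
Proof.
move=> N1 s1 hm mX lX iX.
have [l0 tB rhoe ll lns] := log_parameters s1.
set l := trunc_log 2 s in l0 tB rhoe ll.
set q := Num.sqrt s%:R; set a := ln (s%:R : R) in hm ll lns *.
have s0' : 0 < s%:R :> R by rewrite ltr0n ltnW.
have N0' : 0 < N%:R :> R by rewrite ltr0n ltnW.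
have q2 : q ^+ 2 = s%:R by rewrite sqr_sqrtr ?ler0n.
have q0 : 0 < q by rewrite sqrtr_gt0.
have lnN : 0 < ln N%:R :> R by rewrite ln_gt0 // ltr1n.
have a3 : 0 < a ^+ 3 by rewrite exprn_gt0 //; lra.
have m0 : (0 < m)%N.
  have C0 : 0 < 40 * 40 * 64 * 4 * (7 * (128 * 21)) * 8 :> R by lra.
  exact: (natr_gt0_of_prod_le C0 s0' a3 lnN hm).
split=> //.
(* [chebyshev_measure] is a bare set function; the law of the first sample provides a probability
   measure that agrees with it on measurable sets. *)
have mfX : X (Ordinal m0) \in mfun by rewrite inE; exact: mX.
pose mu : probability Rm R := distribution P (mfun_Sub mfX).
have muE (A : set Rm) : measurable A -> mu A = chebyshev_measure A.
  by move=> mA; rewrite -(lX (Ordinal m0)).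
(* The unit vectors of the cone give convex combinations of these signed atoms of height [4 q]; the
   uniform bound 2 yields [B = 8 q]. *)
pose c (kb : 'I_N * bool) (y : Rm) : R :=
  (-1) ^+ kb.2 * (4 * q) * (precond y * legendreL kb.1 y).
have B2 : (8 * q) ^+ 2 = 64 * s%:R by rewrite exprMn q2; ring.
have mc kb : measurable_fun setT (c kb : Rm -> Rm).
  by apply: (@measurable_funM _ Rm) => //; exact: measurable_precond_legendreL.
have cB kb y : `|c kb y| <= 8 * q.
  rewrite /c [leLHS]normrM (_ : `|(-1) ^+ kb.2 * (4 * q)| = 4 * q); last first.
    by rewrite normrM normrX normrN1 expr1n mul1r gtr0_norm ?mulr_gt0.
  rewrite (_ : 8 * q = 4 * q * 2); last by ring.
  by apply: ler_wpM2l; [rewrite mulr_ge0 ?(ltW q0) | exact: precond_legendreL_le2].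
have lX' j (A : set Rm) : measurable A -> P (X j @^-1` A) = mu A.
  by move=> mA; rewrite lX // muE.
have B0 : 0 < 8 * q by rewrite mulr_gt0.
rewrite -B2 in tB rhoe.
have rho0 : (0 < 128 * (l + 20))%N by rewrite muln_gt0 addn_gt0 orbT.
have [G [mG PG HG]] := convex_hull_energy mX iX lX' mc cB m0 rho0 B0 tB rhoe.
exists G; split => //.
  apply: le_trans PG; rewrite lee_fin lerD2l lerN2.
  rewrite card_prod card_ord card_bool.
  apply: le_trans (union_bound_le _ _ _ B0 _) _.
  - by rewrite (@leq_trans N) // leq_pmulr.
  - by rewrite addn_gt0 l0.
  - by rewrite leq_mul // leq_add2l.
  (* The constant collects [1600 * 64] from [B ^ 2], [ln (2 N) <= 2 ln N], [l + 20 <= 21 l],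
     [l + 6 <= 7 l], and [l ^ 2 <= 4 a ^ 2 <= 8 a ^ 3] for [a = ln s >= 1 / 2]. *)
  - rewrite B2; apply: le_trans hm.
    have lnN2 : ln (N * 2)%:R <= 2 * ln N%:R :> R.
      have ln2 : ln 2 <= ln N%:R :> R by rewrite ler_ln ?posrE // ler_nat.
      by rewrite natrM lnM ?posrE //; lra.
    have l1 : 1 <= l%:R :> R by rewrite ler1n.
    have aa : l%:R * l%:R <= 8 * a ^+ 3.
      have h1 : l%:R * l%:R <= 2 * a * (2 * a) by rewrite ler_pM.
      have h2 : 0 <= a * a * (a - 1 / 2) by rewrite mulr_ge0 ?mulr_ge0 //; lra.
      by rewrite !exprS expr0; lra.
    have ln0 : 0 <= ln (N * 2)%:R :> R by rewrite ln_ge0 // ler1n muln_gt0 (ltnW N1).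
    have hs : 0 <= 40 * 40 * (64 * s%:R) :> R by apply: mulr_ge0 => //; rewrite mulr_ge0.
    have rhoE : (128 * (l + 20))%:R = 128 * (l%:R + 20) :> R by rewrite natrM natrD.
    have tE : (l + 6)%:R = l%:R + 6 :> R by rewrite natrD.
    rewrite rhoE tE.
    apply: (@le_trans _ _ (2 * (128 * (21 * l%:R)) * (2 * ln N%:R) * (7 * l%:R)
        * (40 * 40 * (64 * s%:R)))).
      have rho0' : 0 <= 2 * (128 * (l%:R + 20)) :> R by lra.
      apply: ler_wpM2r => //; apply: ler_pM; [exact: mulr_ge0 | lra | | lra].
      by apply: ler_pM => //; lra.
    have sN : 0 <= s%:R * ln N%:R :> R by rewrite mulr_ge0 ?ltW.
    have := ler_wpM2r sN aa; lra.
  rewrite /powR gt_eqF // ler_expR B2 mulNr lerN2 mul1r ler_pdivlMr; last first.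
    by rewrite mulr_gt0 // mulr_gt0.
  apply: le_trans hm.
  have saN : 0 <= s%:R * (a ^+ 3 * ln N%:R) by apply/ltW/mulr_gt0 => //; exact: mulr_gt0.
  lra.
move=> t Gt v hv.
have v0 := norm2_ge0 v.
have [vz|vn] := eqVneq (norm2 v) 0.
  by rewrite vz expr0n mulr0 sumr_ge0 // => j _; rewrite sqr_ge0.
have {v0} vp : 0 < norm2 v by rewrite lt0r vn.
have L0 : 0 < 4 * q by rewrite mulr_gt0.
(* Both sides are homogeneous of degree 2, so [v] is normalized; its energy is then exactly 1. *)
pose u k := v k / norm2 v.
have uL : norm1 u <= 4 * q.
  have -> : norm1 u = norm1 v / norm2 v.
    by rewrite /norm1 mulr_suml; apply: eq_bigr => k _; rewrite normrM normfV (gtr0_norm vp).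
  by rewrite ler_pdivrMr.
have u2 : \sum_(k < N) u k ^+ 2 = 1.
  under eq_bigr do rewrite expr_div_n.
  by rewrite -mulr_suml -norm2_sq mulfV // expf_neq0.
have combE y : \sum_kb signed_weight (4 * q) u kb * c kb y =
    \sum_(k < N) u k * (precond y * legendreL k y).
  exact: (signed_weight_combE u (fun k : 'I_N => precond y * legendreL k y) L0).
have := HG t Gt (signed_weight (4 * q) u) (fun kb => signed_weight_ge0 kb L0 uL)
  (sum_signed_weight u (ltnW N1) L0).
under eq_integral do rewrite combE.
rewrite legendre_energy // u2 lexx => /(_ isT).
under eq_bigr do rewrite combE.
have -> : \sum_(j < m) (\sum_(k < N) u k * (precond (X j t) * legendreL k (X j t))) ^+ 2 =
    (norm2 v ^+ 2)^-1 * \sum_(j < m) (precond (X j t) * legendre_mat (fun j => X j t) v j) ^+ 2.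
  rewrite mulr_sumr; apply: eq_bigr => j _; rewrite -exprVn -exprMn; congr (_ ^+ 2).
  rewrite /legendre_mat !mulr_sumr; apply: eq_bigr => k _; rewrite /u; ring.
rewrite -ler_pdivrMl ?invr_gt0 ?exprn_gt0 // invrK => h.
by apply: le_trans h; rewrite le_eqVlt; apply/orP; left; apply/eqP; field.
Qed.

Theorem theorem2p1 :
  exists C C1 C2 D1 D2 gamma : R,
    (0 < C /\ 0 < C1 /\ 0 < C2 /\ 0 < D1 /\ 0 < D2 /\ 0 < gamma) /\
    forall (N m s : nat) (eps : R),
      (1 <= N)%N -> (1 <= s)%N -> 0 <= eps ->
      C * s%:R * ln s%:R ^+ 3 * ln N%:R <= m%:R ->
      forall (d : measure_display) (T : measurableType d) (P : probability T R)
             (X : 'I_m -> T -> Rm),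
        (forall j, measurable_fun setT (X j)) ->
        (forall j (A : set Rm), measurable A ->
           P (X j @^-1` A) = chebyshev_measure A) ->
        mutually_independent P X ->
        exists G : set T,
          measurable G /\
          ((1 - powR N%:R (- (gamma * ln s%:R ^+ 3)))%:E <= P G)%E /\
          (forall t, G t ->
                @recovery_property m N s C1 C2 D1 D2 eps (fun j => X j t)).
Proof.
(* The value [1 / 20] is the restricted lower bound constant [k], with [k ^ 2 = 1 / 400]. *)
exists (40 * 40 * 64 * 4 * (7 * (128 * 21)) * 8), 1, (2 / (1 / 20)), 4, (4 / (1 / 20)), 1.
split; first by do !split; lra.
move=> N m s eps N1 s1 eps0 hm d T P X mX lX iX.
(* For [N = 1] or [s = 1] the required probability is 0 and the empty event suffices. *)
have trivial : powR (N%:R : R) (- (1 * ln s%:R ^+ 3)) = 1 ->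
    exists G : set T, measurable G /\
      ((1 - powR (N%:R : R) (- (1 * ln s%:R ^+ 3)))%:E <= P G)%E /\
      (forall t, G t -> @recovery_property m N s 1 (2 / (1 / 20)) 4 (4 / (1 / 20)) eps
         (fun j => X j t)).
  by move=> ->; exists set0; split=> //; split=> [|t //]; rewrite subrr measure0.
have [N2|] := ltnP 1 N; last first.
  by move=> h; apply: trivial; rewrite (_ : N = 1%N) ?powR1 //; apply/eqP; rewrite eqn_leq h.
have [s2|] := ltnP 1 s; last first.
  move=> h; apply: trivial; rewrite (_ : s = 1%N) ?ln1 ?expr0n ?mulr0 ?oppr0 ?powRr0 //.
  by apply/eqP; rewrite eqn_leq h.
have [m0 [G [mG PG HG]]] := restricted_lower_bound N2 s2 hm mX lX iX.
exists G; split => //; split => // t Gt.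
have k0 : 0 < 1 / 20 :> R by lra.
by apply: (recovery_of_restricted_lower_bound m0 s1 k0 eps0) => v; exact: HG.
Qed.
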